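(* Let $n>d\ge 1$. Let $(x_i)_{i=1}^n$ be i.i.d. with $x_i\sim N(0,I_d)$, let $\bar{x}_i=(1,x_i^{\top})^{\top}\in\mathbb{R}^{d+1}$, and suppose the responses $y_1,\dots,y_n\in\{-1,1\}$ are conditionally independent given $(x_i)_{i=1}^n$ with $\frac{y_i+1}{2}\,\big|\,x_i\sim\mathrm{Bernoulli}(\Phi(\bar{x}_i\cdot\bar{\beta}))$ for some fixed $\bar{\beta}=(\beta_0,\beta^{\top})$, $\beta_0\in\mathbb{R}$, $\beta\in\mathbb{R}^d$. Let $\gamma_0=|\beta|$ (so $\gamma_0^2=\mathrm{Var}(x_i\cdot\beta)$), let $Z\sim N(0,1)$ and $h=\mathbb{E}[\Phi(-|\beta_0+\gamma_0Z|)]$ (so $h>0$), and let $$s^*=\inf_{u\in\mathbb{S}^d}\sum_{i=1}^n\mathds{1}_{(-\infty,0]}(y_i\bar{x}_i\cdot u).$$ Then for every $\epsilon>0$, with probability at least $1-\exp(-2\epsilon^2 n)$, $$s^*\ge n\Bigg(h-\epsilon-\bigg(\frac{2\ln(en/(d+1))}{n/(d+1)}\bigg)^{1/2}\Bigg).$$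
   Context: $\Phi$ denotes the standard normal c.d.f. and $\mathbb{S}^d=\{v\in\mathbb{R}^{d+1}:|v|=1\}$. *)

(* Defs.v *)
From HB Require Import structures.
From mathcomp Require Import all_boot all_order all_algebra.
From mathcomp Require Import all_classical all_reals all_analysis.
Set Implicit Arguments. Unset Strict Implicit. Unset Printing Implicit Defensive.
Import Order.TTheory GRing.Theory Num.Theory.
Local Open Scope classical_set_scope.
Local Open Scope ring_scope.

Definition Phi {R : realType} (t : R) : R :=
  fine (normal_prob (0:R) 1 [set` `]-oo, t]]).

Definition sphere {R : realType} (d : nat) : set 'rV[R]_(d.+1) :=
  [set u | \sum_(k < d.+1) (u ord0 k) ^+ 2 = 1].

(* xbar . u  with xbar = (1, x), x : 'I_d -> R *)
Definition xbar_dot {R : realType} (d : nat) (x : 'I_d -> R)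
  (u : 'rV[R]_(d.+1)) : R :=
  u ord0 ord0 + \sum_(j < d) x j * u ord0 (lift ord0 j).

Definition bad_count {R : realType} (n d : nat) (x : 'I_n -> 'I_d -> R)
  (y : 'I_n -> R) (u : 'rV[R]_(d.+1)) : R :=
  (#|[set i : 'I_n | y i * xbar_dot (x i) u <= 0]|)%:R.

Definition sstar {R : realType} (n d : nat) (x : 'I_n -> 'I_d -> R)
  (y : 'I_n -> R) : R :=
  inf [set bad_count x y u | u in @sphere R d].

Definition lin_pred {R : realType} (d : nat) (beta0 : R) (beta : 'I_d -> R)
  (x : 'I_d -> R) : R := beta0 + \sum_(j < d) x j * beta j.

(* P(y | x) for y in {-1,1}: Phi(t) if y = 1, 1 - Phi(t) if y = -1 *)
Definition cond_prob {R : realType} (y t : R) : R :=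
  if y == 1 then Phi t else 1 - Phi t.

Definition h_const {R : realType} (beta0 gamma0 : R) : R :=
  fine (\int[normal_prob (0:R) 1]_z (Phi (- `|beta0 + gamma0 * z|))%:E)%E.

(* Main.v *)
Require Import Defs.
From HB Require Import structures.
From mathcomp Require Import all_boot all_order all_algebra.
From mathcomp Require Import all_classical all_reals all_analysis.
From mathcomp Require Import measurable_realfun ring lra.
Set Implicit Arguments. Unset Strict Implicit. Unset Printing Implicit Defensive.
Import Order.TTheory GRing.Theory Num.Theory.
Import numFieldNormedType.Exports.
Local Open Scope classical_set_scope.
Local Open Scope ring_scope.

(** A direction [u] misclassifies at least the indices where the labels disagree
    with the pattern [A = {i | 0 < xbar_i . u}].  Given the covariates, at most
    [N = (e n / (d+1)) ^ (d+1)] patterns occur (Sauer-Shelah), and for each of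
    them the number of disagreements is a sum of independent Bernoulli variables
    whose parameters are at least [Phi (- |t_i|)], [t_i = xbar_i . betabar].
    Hence [E exp (- l s^* )] is at most [N] times
    [E (prod_i (1 - (1 - exp (- l)) Phi (- |t_i|)))].  The [t_i] are independent and
    distributed as [beta0 + gamma0 Z], so this expectation equals
    [(1 - (1 - exp (- l)) h) ^ n <= exp (n (l ^ 2 / 8 - l h))], and Markov's inequality with
    [l = 4 (eps + r)], [r] the square root in the statement, gives the bound
    [exp (- 2 n eps ^ 2)]: the term [2 n r ^ 2 = 4 ln N] absorbs the factor [N].
    Rational directions suffice throughout, which makes all events measurable. *)

(** * Patterns cut out by half-spaces *)

Section shattering.
Import fintype boot.finset.
Implicit Types I : finType.

Definition shatters I (F : {set {set I}}) (S : {set I}) :=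
  [forall B : {set I}, (B \subset S) ==> [exists A in F, A :&: S == B]].

Lemma shattersP I (F : {set {set I}}) (S : {set I}) :
  reflect (forall B : {set I}, B \subset S -> exists2 A, A \in F & A :&: S = B)
          (shatters F S).
Proof.
apply: (iffP forallP) => [sh B BS|sh B].
  by have /implyP/(_ BS)/existsP[A /andP[AF /eqP]] := sh B; exists A.
apply/implyP => /sh[A AF <-]; apply/existsP; exists A.
by rewrite AF eqxx.
Qed.

Lemma shattersS I (F F' : {set {set I}}) (S : {set I}) :
  F \subset F' -> shatters F S -> shatters F' S.
Proof.
move=> FF' /shattersP sh; apply/shattersP => B /sh[A AF <-].
by exists A => //; exact: (subsetP FF').
Qed.

(** The half containing [x] realises the traces with [x], the other half those without it. This
    covers the sets counted twice in [card_le_shatters]. *)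
Lemma shattersU1 I (F : {set {set I}}) (S : {set I}) x :
  shatters [set A in F | x \in A] S -> shatters [set A in F | x \notin A] S ->
  shatters F (x |: S).
Proof.
move=> /shattersP sh1 /shattersP sh0; apply/shattersP => B BxS.
have BxS' : B :\ x \subset S by rewrite subDset.
have [xB|xB] := boolP (x \in B).
  have [A] := sh1 _ BxS'; rewrite inE => /andP[AF xA] AS.
  exists A => //; rewrite setIUr AS (_ : A :&: [set x] = [set x]) ?setD1K//.
  by apply/setIidPr; rewrite sub1set.
have [A] := sh0 _ BxS'; rewrite inE => /andP[AF xA] AS.
exists A => //; rewrite setIUr AS (_ : A :&: [set x] = set0).
  rewrite set0U; apply/setP => z; rewrite !inE.
  by have [->|//] := eqVneq z x; rewrite (negbTE xB).
apply/setP => z; rewrite !inE.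
by have [->|] := eqVneq z x; [rewrite (negbTE xA)|rewrite andbF].
Qed.

(** Pajor's form of the Sauer-Shelah lemma. Split [F] at a point [x]: sets shattered by either half
    are shattered by [F], and a set [S] shattered by both halves yields a second one, [x |: S]. *)
Lemma card_le_shatters I (F : {set {set I}}) : (#|F| <= #|[set S | shatters F S]|)%N.
Proof.
have [m] := ubnP #|F|; elim: m F => // m IH F /ltnSE leFm.
have [F1|] := leqP #|F| 1.
  have [->|[A AF]] := set_0Vmem F; first by rewrite cards0.
  apply: (leq_trans F1); rewrite card_gt0; apply/set0Pn.
  exists set0; rewrite inE; apply/shattersP => B.
  by rewrite subset0 => /eqP ->; exists A => //; rewrite setI0.
move=> /card_gt1P[A [B [AF BF AB]]].
(* A point separating two members makes both halves nonempty, hence both strictly smaller than [F],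
   as the induction needs. *)
have [x xAB] : exists x, (x \in A) != (x \in B).
  apply/existsP; apply: contraR AB; rewrite negb_exists => /forallP AB.
  by apply/eqP/setP => x; apply/eqP; rewrite -[_ == _]negbK.
pose F1 := [set A in F | x \in A]; pose F0 := [set A in F | x \notin A].
have F01 : #|F| = (#|F1| + #|F0|)%N.
  rewrite -(cardsID [set A : {set I} | x \in A] F); congr (_ + _)%N.
    by apply: eq_card => C; rewrite !inE.
  by apply: eq_card => C; rewrite !inE andbC.
have F1gt0 : (0 < #|F1|)%N.
  rewrite card_gt0; apply/set0Pn.
  case: (boolP (x \in A)) xAB => [xA _|xA xB]; first by exists A; rewrite inE AF.
  by exists B; rewrite inE BF; case: (x \in B) xB.
have F0gt0 : (0 < #|F0|)%N.
  rewrite card_gt0; apply/set0Pn.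
  case: (boolP (x \in A)) xAB => [xA xB|xA _]; last by exists A; rewrite inE AF.
  by exists B; rewrite inE BF; case: (x \in B) xB.
set G1 := [set S | shatters F1 S]; set G0 := [set S | shatters F0 S].
(* All members of [F1] contain [x], so none could cut out [S :\ x] if [x] were in [S]; dually for
   [F0]. *)
have xG1 S : S \in G1 -> x \notin S.
  rewrite inE => /shattersP/(_ (S :\ x)); rewrite subsetDl => /(_ isT)[C].
  rewrite inE => /andP[_ xC] /setP/(_ x); rewrite !inE xC eqxx /=.
  by move=> ->.
have xG0 S : S \in G0 -> x \notin S.
  rewrite inE => /shattersP/(_ S (subxx _))[C].
  rewrite inE => /andP[_ xC] /setP/(_ x); rewrite !inE (negbTE xC) /=.
  by move=> <-.
have leG : (#|F| <= #|G1| + #|G0|)%N.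
  rewrite F01 leq_add// IH//.
    by apply: leq_trans leFm; rewrite F01 -[ltnLHS]addn0 ltn_add2l.
  by apply: leq_trans leFm; rewrite F01 -[ltnLHS]add0n ltn_add2r.
apply: (leq_trans leG); rewrite -cardsUI.
(* Sets counted twice are charged to their extensions by [x], which are new because no set of [G1]
   or [G0] contains [x]. *)
pose G2 := [set x |: S | S in G1 :&: G0].
have <- : #|G2| = #|G1 :&: G0|.
  apply: card_in_imset => S S' /setIP[/xG1 xS _] /setIP[/xG1 xS' _].
  by move=> /(congr1 (fun U : {set I} => U :\ x)); rewrite !setU1K.
rewrite -cardsUI (_ : _ :&: G2 = set0) ?cards0 ?addn0; last first.
  apply/setP => S; rewrite !in_set0; apply/negbTE/negP.
  move=> /setIP[/setUP SG /imsetP[S' _ SS']].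
  have : x \notin S by case: SG => [/xG1|/xG0].
  by rewrite SS' !inE eqxx.
apply/subset_leq_card/subsetP => S /setUP[/setUP[|]|].
- by rewrite !inE; apply: shattersS; apply/subsetP => C; rewrite inE => /andP[].
- by rewrite !inE; apply: shattersS; apply/subsetP => C; rewrite inE => /andP[].
- by move=> /imsetP[S' /setIP[]]; rewrite !inE => h1 h0 ->; exact: shattersU1.
Qed.

(* A nontrivial linear relation among the [v i], [i \in S], forbids the pattern
   that is positive exactly on the positive coefficients of the relation. *)
Lemma halfspace_shatters_card (R : realFieldType) (I : finType) (D : nat)
    (v : I -> 'I_D -> R) (F : {set {set I}}) (S : {set I}) :
  (forall A, A \in F ->
     exists u : 'I_D -> R, forall i, (i \in A) = (0 < \sum_k v i k * u k)) ->
  shatters F S -> (#|S| <= D)%N.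
Proof.
move=> Fv /shattersP sh; rewrite leqNgt; apply/negP => DS.
pose M := \matrix_(a < #|S|, k < D) v (enum_val a) k.
(* More than [D] vectors in dimension [D] are dependent. Up to a change of sign the relation has a
   positive coefficient, which makes the final sum strictly positive. *)
have [c cM [a0 ca0]] : exists2 c : 'rV_#|S|, c *m M = 0 & exists a, 0 < c 0 a.
  have /rowV0Pn[c /sub_kermxP cM c0] : kermx M != 0.
    by rewrite -mxrank_eq0 mxrank_ker subn_eq0 -ltnNge (leq_ltn_trans (rank_leq_col _)).
  have [a ca] : exists a, c 0 a != 0.
    apply/existsP; apply: contraR c0; rewrite negb_exists => /forallP c0.
    by apply/eqP/rowP => a; rewrite mxE; apply/eqP; rewrite -[_ == _]negbK.
  have [cgt|cle] := ltP 0 (c 0 a); first by exists c => //; exists a.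
  exists (- c); first by rewrite mulNmx cM oppr0.
  by exists a; rewrite mxE oppr_gt0 lt_neqAle ca.
have [|A AF AS] := sh [set enum_val a | a : 'I_#|S| & 0 < c 0 a].
  by apply/subsetP => i /imsetP[a _ ->]; exact: enum_valP.
have Ac a : (enum_val a \in A) = (0 < c 0 a).
  have := congr1 (fun B : {set I} => enum_val a \in B) AS.
  rewrite inE enum_valP andbT => ->; apply/imsetP/idP => [[b cb]|ca].
    by move=> /enum_val_inj ->; rewrite inE in cb.
  by exists a; rewrite ?inE.
have [u Au] := Fv A AF.
pose f a := c 0 a * \sum_k v (enum_val a) k * u k.
have f0 : \sum_a f a = 0.
  rewrite /f; under eq_bigr do rewrite mulr_sumr.
  rewrite exchange_big /= big1// => k _.
  under eq_bigr do rewrite mulrA.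
  rewrite -mulr_suml.
  have := congr1 (fun B : 'rV_D => B 0 k) cM; rewrite !mxE => cMk.
  suff -> : \sum_a c 0 a * v (enum_val a) k = 0 by rewrite mul0r.
  by rewrite -[RHS]cMk; apply: eq_bigr => a _; rewrite mxE.
(* On [S] the set [A] marks the positive coefficients, so a coefficient and its scalar product are
   both positive or both nonpositive. *)
have fge0 a : 0 <= f a.
  rewrite /f; have := Ac a; rewrite Au; case: (ltP 0 (c 0 a)) => [ca|ca] fa.
    by rewrite mulr_ge0 ?ltW ?fa.
  by apply: mulr_le0 => //; rewrite leNgt fa.
have : 0 < \sum_a f a.
  rewrite (bigD1 a0)//= ltr_pwDl ?sumr_ge0//.
  by rewrite mulr_gt0// -Au Ac.
by rewrite f0 ltxx.
Qed.

Lemma card_sets_le (n D : nat) :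
  #|[set S : {set 'I_n} | (#|S| <= D)%N]| = \sum_(k < D.+1) 'C(n, k).
Proof.
rewrite -sum1_card (partition_big (fun S : {set 'I_n} => inord #|S| : 'I_D.+1) xpredT)//=.
apply: eq_bigr => k _; rewrite sum1_card -[in RHS](card_ord n) -card_draws.
apply: eq_card => S; rewrite [in RHS]inE unfold_in /= inE.
have [SD|SD] /= := leqP #|S| D.
  by rewrite -val_eqE /= inordK ?ltnS.
by apply/esym/negbTE; apply: contraL SD => /eqP ->; rewrite -leqNgt -ltnS.
Qed.

End shattering.

(** With [t = D / n <= 1] one has [t ^ D <= t ^ k] for [k <= D], so [t ^ D] times the sum is at most
    [(1 + t) ^ n <= expR (t * n) = expR D]. *)
Lemma sum_bin_le (R : realType) (n D : nat) : (0 < D <= n)%N ->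
  (\sum_(k < D.+1) 'C(n, k))%:R <= (expR 1 * n%:R / D%:R) ^+ D :> R.
Proof.
move=> /andP[D0 Dn]; have n0 : (0 < n)%N by exact: leq_trans Dn.
have Dr0 : 0 < D%:R :> R by rewrite ltr0n.
have nr0 : 0 < n%:R :> R by rewrite ltr0n.
pose t : R := D%:R / n%:R.
have t0 : 0 < t by rewrite divr_gt0.
have t1 : t <= 1 by rewrite ler_pdivrMr// mul1r ler_nat.
have tD : t ^+ D * (\sum_(k < D.+1) 'C(n, k))%:R <= expR 1 ^+ D.
  apply: (@le_trans _ _ (\sum_(k < n.+1) t ^+ k *+ 'C(n, k))).
    rewrite natr_sum mulr_sumr (big_ord_widen n.+1 (fun k => t ^+ D * 'C(n, k)%:R)) ?ltnS//.
    rewrite [leRHS](bigID (fun k : 'I_n.+1 => (k < D.+1)%N)) /= -[leLHS]addr0.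
    apply: lerD; last by apply: sumr_ge0 => k _; rewrite mulrn_wge0// exprn_ge0// ltW.
    apply: ler_sum => k kD; rewrite -[leRHS]mulr_natr ler_wpM2r//.
    by apply: ler_wiXn2l => //; rewrite ?ltW// t1 ltW.
  have -> : \sum_(k < n.+1) t ^+ k *+ 'C(n, k) = (1 + t) ^+ n.
    by rewrite exprDn; apply: eq_bigr => k _; rewrite expr1n mul1r.
  apply: (@le_trans _ _ (expR t ^+ n)).
    by apply: lerXn2r; rewrite ?nnegrE ?expR_ge0 ?expR_ge1Dx ?addr_ge0 ?ltW.
  rewrite -!expRM_natl /t mulrC divfK ?gt_eqF//; first by rewrite mulr1.
rewrite -(ler_pM2l (exprn_gt0 D t0)); apply: (le_trans tD).
rewrite -exprMn /t.
have -> : D%:R / n%:R * (expR 1 * n%:R / D%:R) = expR 1 :> R.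
  by field; rewrite ?gt_eqF.
by [].
Qed.

(** * Hoeffding's lemma for Bernoulli variables *)

Lemma derive_ge0_le (R : realType) (f df : R -> R) :
  (forall x : R, is_derive x 1 f (df x)) -> (forall x, 0 <= x -> 0 <= df x) ->
  forall x, 0 <= x -> f 0 <= f x.
Proof.
move=> fdf df0 x x0.
have [|c] := MVT_segment x0 (fun y _ => fdf y).
  apply: continuous_subspaceT => y.
  apply: differentiable_continuous; apply/derivable1_diffP.
  exact: ex_derive.
rewrite in_itv/= => /andP[c0 _] fx.
by rewrite -subr_ge0 fx subr0 mulr_ge0// df0.
Qed.

(** The difference [G] of the logarithms of the two sides vanishes at 0, and so does its derivative
    [G1]; the second derivative is [1/4 - p (1 - p) >= 0]. Two integrations give [G >= 0] on the
    positive half-line. *)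
Lemma bernoulli_mgf_le (R : realType) (h l : R) : 0 <= h <= 1 -> 0 <= l ->
  1 - h + h * expR (- l) <= expR (l ^+ 2 / 8 - l * h).
Proof.
move=> /andP[h0 h1] l0.
pose W (x : R) := 1 - h + h * expR (- x).
have W0 x : 0 < W x.
  rewrite /W; have := expR_gt0 (- x); have [->|hn0] := eqVneq h 0; first by lra.
  by move=> e0; rewrite ltr_wpDl ?subr_ge0// mulr_gt0// lt0r hn0.
have dW (x : R) : is_derive x 1 W (- (h * expR (- x))).
  by rewrite /W; apply: is_derive_eq; rewrite /GRing.scale/=; ring.
(* The parameter of the exponentially tilted Bernoulli law; [p (1 - p)] is its variance. *)
pose p (x : R) := h * expR (- x) / W x.
pose G1 (x : R) := x / 4 - h + p x.
have dG1 (x : R) : is_derive x 1 G1 (4^-1 - p x * (1 - p x)).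
  have Wx := lt0r_neq0 (W0 x).
  by rewrite /G1 /p; apply: is_derive_eq; rewrite /GRing.scale/=; field.
have G1_ge0 x : 0 <= x -> 0 <= G1 x.
  move=> x0; have G10 : G1 0 = 0 by rewrite /G1 /p /W oppr0 expR0; field; lra.
  rewrite -[leLHS]G10; apply: (derive_ge0_le dG1) => // y _.
  by have := sqr_ge0 (p y - 2^-1); lra.
pose G (x : R) := x ^+ 2 / 8 - x * h - ln (W x).
have dG (x : R) : is_derive x 1 G (G1 x).
  have lnW : is_derive x 1 (fun x => ln (W x)) ((W x)^-1 * - (h * expR (- x))).
    have dln := is_derive1_ln (W0 x).
    exact: is_derive1_comp.
  rewrite /G; apply: is_derive_eq; rewrite /G1 /p /GRing.scale/=.
  by have Wx := lt0r_neq0 (W0 x); field.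
have : G 0 <= G l by exact: (derive_ge0_le dG).
rewrite /G /W oppr0 expR0 (_ : 1 - h + h * 1 = 1); last by ring.
rewrite ln1 expr0n/= !mul0r !subr0 subr_ge0 => Wl.
by rewrite -[leLHS]lnK ?ler_expR// posrE; exact: W0.
Qed.

(** * Equality of integrals on a generated sigma-algebra *)

Section density.
Context d (T : measurableType d) (R : realType).
Variable mu : {measure set T -> \bar R}.
Local Open Scope ereal_scope.

(** The measurability and sign of [u] are arguments so that the measure structure can be attached to
    the term itself. *)
Definition mdensity (u : T -> R) of measurable_fun setT u & (forall x, (0 <= u x)%R) :=
  fun A : set T => \int[mu]_(x in A) (u x)%:E.

Variables (u : T -> R) (mu_u : measurable_fun setT u) (u0 : forall x, (0 <= u x)%R).
Local Notation nu := (mdensity mu_u u0).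

Let mdensity0 : nu set0 = 0.
Proof. exact: integral_set0. Qed.

Let mdensity_ge0 A : 0 <= nu A.
Proof. by apply: integral_ge0 => x _; rewrite lee_fin. Qed.

Let mdensity_sigma_additive : semi_sigma_additive nu.
Proof.
move=> F mF tF mUF; rewrite /mdensity ge0_integral_bigcup//.
- apply: is_cvg_ereal_nneg_natsum_cond => n _ _.
  by apply: integral_ge0 => x _; rewrite lee_fin.
- exact/measurable_EFinP/measurable_funTS.
- by move=> x _; rewrite lee_fin.
Qed.

HB.instance Definition _ := isMeasure.Build _ _ _ nu
  mdensity0 mdensity_ge0 mdensity_sigma_additive.

Import HBNNSimple.

(** Both sides are limits along increasing simple approximations of [f]; on each level set the
    identity is the definition of the density. *)
Lemma ge0_integral_mdensity (f : T -> \bar R) :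
  measurable_fun setT f -> (forall x, 0 <= f x) ->
  \int[nu]_x f x = \int[mu]_x (f x * (u x)%:E).
Proof.
move=> mf f0; pose h := nnsfun_approx measurableT mf.
have fE x : f x = limn (fun n => (h n x)%:E).
  by apply/esym/cvg_lim => //; exact: cvg_nnsfun_approx.
have -> : \int[nu]_x f x = limn (fun n => \int[nu]_x (h n x)%:E).
  rewrite -monotone_convergence//.
  - by apply: eq_integral => x _; exact: fE.
  - by move=> n; exact/measurable_EFinP.
  - by move=> n x _; rewrite lee_fin.
  - by move=> x _ a b ab; rewrite lee_fin; exact/lefP/nd_nnsfun_approx.
have -> : \int[mu]_x (f x * (u x)%:E) =
    limn (fun n => \int[mu]_x ((h n x)%:E * (u x)%:E)).
  rewrite -monotone_convergence//.
  - apply: eq_integral => x _; apply/esym/cvg_lim => //.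
    by apply: cvgeZr => //; exact: cvg_nnsfun_approx.
  - by move=> n; apply: emeasurable_funM; exact/measurable_EFinP.
  - by move=> n x _; rewrite mule_ge0// lee_fin.
  - move=> x _ a b ab; rewrite lee_wpmul2r ?lee_fin//.
    exact/lefP/nd_nnsfun_approx.
congr (limn _); apply/funext => n.
have m1 r : measurable_fun setT (fun x => (r * \1_(h n @^-1` [set r]) x)%:E).
  by apply/measurable_EFinP/measurable_funM.
under [LHS]eq_integral do rewrite fimfunE -fsumEFin//.
rewrite ge0_integral_fsum//; last by move=> r x _; exact: nnfun_muleindic_ge0.
under [RHS]eq_integral => x _.
  rewrite fimfunE -fsumEFin// ge0_mule_fsuml => [|r]; last exact: nnfun_muleindic_ge0.
  over.
rewrite ge0_integral_fsum//; last 2 first.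
  - by move=> r; apply: emeasurable_funM => //; exact/measurable_EFinP.
  - by move=> r x _; rewrite mule_ge0 ?lee_fin//; exact: nnfun_muleindic_ge0.
apply: eq_fsbigr => r /[!inE] -[t _ rE].
under [LHS]eq_integral do rewrite EFinM.
under [RHS]eq_integral do rewrite EFinM -muleA.
have r0 : (0 <= r)%R by rewrite -rE.
rewrite !ge0_integralZl//; last first.
- exact/measurable_EFinP.
- by move=> x _; rewrite mule_ge0 ?lee_fin.
- by apply: emeasurable_funM; exact/measurable_EFinP.
rewrite integral_indic// setIT; congr (_ * _).
transitivity (\int[mu]_(x in h n @^-1` [set r]) (u x)%:E) => //.
rewrite [LHS]integral_mkcond; apply: eq_integral => x _.
by rewrite muleC epatch_indic.
Qed.

End density.

Section replacement.
Context d (T : measurableType d) (R : realType).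
Variable mu : {measure set T -> \bar R}.
Local Open Scope ereal_scope.

(* [u] and [v] have the same conditional expectation given the sigma-algebra
   generated by the pi-system [G]. *)
Lemma eq_integral_pi_system (G : set (set T)) (u v : T -> R) (f : T -> \bar R) :
  G `<=` measurable -> setI_closed G -> G setT ->
  measurable_fun setT u -> measurable_fun setT v ->
  (forall x, (0 <= u x)%R) -> (forall x, (0 <= v x)%R) ->
  \int[mu]_x (u x)%:E < +oo ->
  (forall A, G A -> \int[mu]_(x in A) (u x)%:E = \int[mu]_(x in A) (v x)%:E) ->
  measurable_fun [set: g_sigma_algebraType G] f -> (forall x, 0 <= f x) ->
  \int[mu]_x (f x * (u x)%:E) = \int[mu]_x (f x * (v x)%:E).
Proof.
move=> Gm GI GT mu_u mv u0 v0 uoo uv mf f0.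
have sGm : <<s G >> `<=` measurable.
  exact: smallest_sub (@sigma_algebra_measurable _ T) Gm.
(* Two finite measures that agree on a pi-system containing the whole space agree on the generated
   sigma-algebra. *)
have uvE A : <<s G >> A -> mdensity mu mu_u u0 A = mdensity mu mv v0 A.
  apply: (g_sigma_algebra_measure_unique G Gm (fun=> setT)) => //.
  by rewrite bigcup_const.
have mid : measurable_fun [set: T] (id : T -> g_sigma_algebraType G).
  by move=> _ A mA; rewrite setTI; exact: sGm.
have mfT : measurable_fun [set: T] f.
  by move=> _ A mA; apply: sGm; exact: mf.
rewrite -(ge0_integral_mdensity mu mu_u u0)//.
rewrite -(ge0_integral_mdensity mu mv v0)//.
(* Pushing forward along the identity to the coarser sigma-algebra leaves only sets of [<<s G >>] to
   compare. *)
have pE (m : {measure set T -> \bar R}) :=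
  ge0_integral_pushforward mid m measurableT mf (fun x _ => f0 x).
rewrite -[LHS]pE -[RHS]pE; apply: eq_measure_integral => A mA _.
exact: uvE.
Qed.

End replacement.

(** * Independent families *)

Lemma sub_g_sigma_measurable_fun d (T : measurableType d) d' (U : measurableType d')
    (G : set (set T)) (f : T -> U) : G `<=` measurable ->
  measurable_fun [set: g_sigma_algebraType G] f -> measurable_fun [set: T] f.
Proof.
move=> Gm mf _ A mA.
have sGm : <<s G >> `<=` measurable.
  exact: smallest_sub (@sigma_algebra_measurable _ T) Gm.
by apply: sGm; exact: mf.
Qed.

Lemma g_sigma_measurable_indic d (T : measurableType d) (R : realType)
    (G : set (set T)) (A : set T) : G A ->
  measurable_fun [set: g_sigma_algebraType G] (\1_A : T -> R).
Proof.
move=> GA; apply: (@measurable_indic _ (g_sigma_algebraType G)).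
exact: sub_sigma_algebra.
Qed.

Section independence.
Context d (T : measurableType d) (R : realType) (P : probability T R).
Local Open Scope ereal_scope.

Lemma integral01_fin_num (f : T -> R) : measurable_fun setT f ->
  (forall x, (0 <= f x <= 1)%R) -> \int[P]_x (f x)%:E \is a fin_num.
Proof.
move=> mf f01; rewrite ge0_fin_numE; last first.
  by apply: integral_ge0 => x _; rewrite lee_fin; case/andP: (f01 x).
apply: (@le_lt_trans _ _ (\int[P]_x (cst 1 x))).
  apply: ge0_le_integral => //=.
  - by move=> x _; rewrite lee_fin; case/andP: (f01 x).
  - exact/measurable_EFinP.
  - by move=> x _; rewrite lee_fin; case/andP: (f01 x).
by rewrite integral_cst//= probability_setT mul1e ltry.
Qed.

Lemma integral_prod_indep n (G : 'I_n -> set (set T)) (f : 'I_n -> T -> R) :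
  (forall i, G i `<=` measurable) -> (forall i, setI_closed (G i)) ->
  (forall i, G i setT) ->
  (forall B : 'I_n -> set T, (forall i, G i (B i)) ->
    P (\bigcap_(i in setT) B i) = \prod_(i < n) P (B i)) ->
  (forall i, measurable_fun [set: g_sigma_algebraType (G i)] (f i)) ->
  (forall i x, (0 <= f i x <= 1)%R) ->
  \int[P]_x (\prod_(i < n) f i x)%:E = \prod_(i < n) \int[P]_x (f i x)%:E.
Proof.
move=> Gm GI GT indep; move: f.
(* In [H k] the factors of index below [k] are arbitrary and the others are indicators of generating
   sets: [k = 0] is the independence hypothesis, [k = n] the claim. *)
suff H k : forall f : 'I_n -> T -> R,
    (forall i, measurable_fun [set: g_sigma_algebraType (G i)] (f i)) ->
    (forall i x, (0 <= f i x <= 1)%R) ->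
    (forall i : 'I_n, (k <= i)%N -> exists2 B, G i B & f i = \1_B) ->
    \int[P]_x (\prod_(i < n) f i x)%:E = \prod_(i < n) \int[P]_x (f i x)%:E.
  move=> f mf f01; apply: (H n) => // i.
  by rewrite leqNgt ltn_ord.
elim: k => [f mf f01 fB|k IH f mf f01 fB].
  have {}fB i : exists B, G i B /\ f i = \1_B.
    by have [//|B] := fB i; exists B.
  have [B BP] := choice fB.
  have mB i : measurable (B i) by apply: Gm; exact: (BP i).1.
  transitivity (P (\bigcap_(i in setT) B i)).
    have mBI : measurable (\bigcap_(i in setT) B i).
      by apply: fin_bigcap_measurable => //; exact: finite_finset.
    rewrite -[X in P X]setIT -(integral_indic P measurableT mBI).
    apply: eq_integral => x _; congr EFin; rewrite indicE.
    under eq_bigr do rewrite (BP _).2 indicE.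
    have [xB|] := boolP (x \in \bigcap_(i in setT) B i).
      rewrite big1// => i _; rewrite mem_set//.
      by move: xB; rewrite inE; apply.
    move=> xB; have [i xBi] : exists i, ~~ (x \in B i).
      apply: contrapT => /forallNP h; move/negP: xB; apply; rewrite inE => i _.
      by have /negP := h i; rewrite negbK inE.
    by rewrite (bigD1 i)//= (negbTE xBi) mul0r.
  rewrite indep; last by move=> i; exact: (BP i).1.
  by apply: eq_bigr => i _; rewrite (BP _).2 integral_indic// setIT.
have [nk|kn] := leqP n k.
  by apply: IH => // i ki; have := ltn_ord i; rewrite ltnNge (leq_trans nk).
pose i0 := Ordinal kn.
have mfT i : measurable_fun [set: T] (f i).
  exact: (sub_g_sigma_measurable_fun (Gm i)).
pose u x := (\prod_(i < n | i != i0) f i x)%R.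
pose c := (\prod_(i < n | i != i0) fine (\int[P]_x (f i x)%:E))%R.
have cE : c%:E = \prod_(i < n | i != i0) \int[P]_x (f i x)%:E.
  rewrite /c -prodEFin; apply: eq_bigr => i _; rewrite fineK//.
  exact: integral01_fin_num.
have u01 x : (0 <= u x <= 1)%R.
  rewrite /u; apply/andP; split.
    by apply: prodr_ge0 => i _; case/andP: (f01 i x).
  by apply: prodr_ile1 => i _; exact: f01.
have mu : measurable_fun setT u.
  rewrite /u; under eq_fun do rewrite -big_filter.
  by apply: measurable_prod => i _; exact: mfT.
have c0 : (0 <= c)%R.
  apply: prodr_ge0 => i _; apply/fine_ge0/integral_ge0 => x _.
  by rewrite lee_fin; case/andP: (f01 i x).
transitivity (\int[P]_x ((f i0 x)%:E * (u x)%:E)).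
  by apply: eq_integral => x _; rewrite -EFinM (bigD1 i0).
rewrite (bigD1 i0)//= -cE.
(* Against a function measurable for [G i0], the product [u] of the other factors may be replaced by
   the product [c] of their means. *)
transitivity (\int[P]_x ((f i0 x)%:E * c%:E)); last first.
  rewrite ge0_integralZr//; first exact/measurable_EFinP.
  by move=> x _; rewrite lee_fin; case/andP: (f01 i0 x).
apply: (eq_integral_pi_system (G := G i0)) => //.
- by move=> x; case/andP: (u01 x).
- by rewrite -ge0_fin_numE ?integral01_fin_num//; apply: integral_ge0 => x _;
     rewrite lee_fin; case/andP: (u01 x).
- move=> A GA; have mA := Gm _ _ GA.
  (* With an indicator in position [i0], the product falls under the induction hypothesis. *)
  pose f' i := if i == i0 then \1_A else f i.
  have IHf' : \int[P]_x (\prod_(i < n) f' i x)%:E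
      = \prod_(i < n) \int[P]_x (f' i x)%:E.
    apply: IH => [i|i x|i ki]; rewrite /f'; case: eqP => [ii|/eqP ii0].
    - rewrite ii; exact: g_sigma_measurable_indic.
    - exact: mf.
    - by rewrite indicE; case: (_ \in _); rewrite /= ?lexx ?ler01.
    - exact: f01.
    - by exists A; rewrite ?ii.
    - by apply: fB; rewrite ltn_neqAle ki andbT eq_sym.
  transitivity (\int[P]_x (\prod_(i < n) f' i x)%:E).
    rewrite integral_mkcond; apply: eq_integral => x _.
    rewrite (bigD1 i0)//= {1}/f' eqxx epatch_indic/= -EFinM mulrC.
    congr (_ * _)%:E; apply: eq_bigr => i /negbTE ii0.
    by rewrite /f' ii0.
  rewrite IHf' (bigD1 i0)//= {1}/f' eqxx integral_indic// setIT.
  rewrite (eq_bigr (fun i => \int[P]_x (f i x)%:E)); last first.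
    by move=> i /negbTE ii0; rewrite /f' ii0.
  by rewrite -cE integral_cst// muleC.
- exact/measurable_EFinP.
- by move=> x; rewrite lee_fin; case/andP: (f01 i0 x).
Qed.

End independence.

(** * Stability of the normal law *)

Section gauss.
Context {R : realType}.
Local Notation mu := lebesgue_measure.
Local Open Scope ereal_scope.

Lemma measurable_affine (m s : R) :
  measurable_fun [set: measurableTypeR R]
    ((fun z => m + s * z)%R : measurableTypeR R -> measurableTypeR R).
Proof. by apply: measurable_funD => //; exact: measurable_funM. Qed.

(** The right-hand side is a measure in [A], and Lebesgue measure is determined by its values on
    half-open intervals. *)
Lemma lebesgue_measure_affine (m s : R) (A : set R) : s != 0%R -> measurable A ->
  mu A = `|s|%:E * mu ((fun z => m + s * z)%R @^-1` A).
Proof.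
move=> s0 mA; have ns0 : (0 <= `|s|)%R by [].
have nsgt0 : (0 < `|s|)%R by rewrite normr_gt0.
apply: (@lebesgue_measure_unique R (mscale (NngNum ns0)
  (pushforward mu ((fun z => m + s * z)%R : measurableTypeR R -> measurableTypeR R)))) => //.
  exact: measurable_affine.
move=> mphi _ [[a b] _ <-]; rewrite /mscale /pushforward /=.
have sE : (s * s^-1 = 1)%R by rewrite divff.
have [sp|sn|s0'] := ltgtP 0%R s; last by rewrite -s0' eqxx in s0.
  rewrite [X in _ = _ * mu X](_ : _ = `]((a - m) / s)%R, ((b - m) / s)%R]%classic); last first.
    apply/seteqP; split => z /=; rewrite !in_itv/= => /andP[h1 h2]; apply/andP; split.
    + by rewrite ltr_pdivrMr//; lra.
    + by rewrite ler_pdivlMr//; lra.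
    + by move: h1; rewrite ltr_pdivrMr//; lra.
    + by move: h2; rewrite ler_pdivlMr//; lra.
  rewrite !lebesgue_measure_itv/= !lte_fin ltr_pM2r ?invr_gt0// ltrD2r.
  case: ifP => _; last by rewrite mule0.
  by rewrite -!EFinD -EFinM gtr0_norm//; congr EFin; field.
(* A negative slope swaps the endpoints, so the preimage is closed on the left and open on the
   right. *)
rewrite [X in _ = _ * mu X](_ : _ = `[((b - m) / s)%R, ((a - m) / s)%R[%classic); last first.
  apply/seteqP; split => z /=; rewrite !in_itv/= => /andP[h1 h2]; apply/andP; split.
  + by rewrite ler_ndivrMr//; lra.
  + by rewrite ltr_ndivlMr//; lra.
  + by move: h2; rewrite ltr_ndivlMr//; lra.
  + by move: h1; rewrite ler_ndivrMr//; lra.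
rewrite !lebesgue_measure_itv/= !lte_fin ltr_nM2r ?invr_lt0// ltrD2r.
case: ifP => _; last by rewrite mule0.
by rewrite -!EFinD -EFinM ltr0_norm//; congr EFin; field.
Qed.

Lemma integral_affine (m s : R) (f : R -> \bar R) : s != 0%R ->
  measurable_fun [set: R] f -> (forall x, 0 <= f x) ->
  \int[mu]_x f x = `|s|%:E * \int[mu]_z f (m + s * z)%R.
Proof.
move=> s0 mf f0.
have nsgt0 : (0 < `|s|)%R by rewrite normr_gt0.
have ns0 : (0 <= `|s|^-1)%R by rewrite invr_ge0.
have -> : \int[mu]_z f (m + s * z)%R = \int[mscale (NngNum ns0) mu]_x f x.
  rewrite -(ge0_integral_pushforward (measurable_affine m s) mu measurableT mf
    (fun x _ => f0 x)).
  apply: eq_measure_integral => [|mphi A mA _]; first exact: measurable_affine.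
  change (mu ((fun z => m + s * z)%R @^-1` A) = `|s|^-1%:E * mu (A : set R)).
  rewrite (lebesgue_measure_affine m s0 mA).
  by rewrite muleA -EFinM mulVf ?mul1e// gt_eqF.
by rewrite ge0_integral_mscale//= muleA -EFinM divff ?mul1e// gt_eqF.
Qed.

(** The Jacobian [|s|] cancels the ratio of the two peaks. Negative [s] is allowed, which yields the
    reflection in [normal_prob_opp]. *)
Lemma normal_prob_affine (m s : R) (A : set R) : s != 0%R -> measurable A ->
  normal_prob 0 1 ((fun z => m + s * z)%R @^-1` A) = normal_prob m s A.
Proof.
move=> s0 mA; rewrite /normal_prob integral_mkcond [RHS]integral_mkcond.
have nsgt0 : (0 < `|s|)%R by rewrite normr_gt0.
have mpdf : measurable_fun [set: R] ((fun x => (normal_pdf m s x)%:E) \_ A).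
  apply/(measurable_restrictT _ mA)/measurable_funTS/measurable_EFinP.
  exact: measurable_normal_pdf.
rewrite [RHS](integral_affine m s0)//; last first.
  by move=> x; apply: erestrict_ge0 => y _; rewrite lee_fin normal_pdf_ge0.
rewrite -ge0_integralZl//; last 2 first.
- exact: (measurableT_comp mpdf (measurable_affine m s)).
- by move=> x _; apply: erestrict_ge0 => y _; rewrite lee_fin normal_pdf_ge0.
apply: eq_integral => z _; rewrite !patchE.
rewrite (_ : (z \in _) = (m + s * z \in A)%R) //; case: ifPn => _; last by rewrite mule0.
rewrite -EFinM; congr EFin.
rewrite !normal_pdfE ?oner_neq0// /normal_peak /normal_fun.
rewrite subr0 addrC addKr mulrA; congr (_ * expR _)%R; last first.
  by rewrite expr1n exprMn; field.
rewrite expr1n mul1r -mulrnAr sqrtrM ?sqr_ge0// sqrtr_sqr invfM mulrA divff ?mul1r//.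
by rewrite gt_eqF.
Qed.

(** Bayes' formula for a Gaussian pair: the joint density of [x] and [s = a x + b y] is the marginal
    density of [s] times the conditional density of [x] given [s]. *)
Lemma normal_pdf_mul (a b x s : R) : b != 0%R ->
  let c := Num.sqrt (a ^+ 2 + b ^+ 2) in
  (normal_pdf 0 1 x * normal_pdf (a * x) b s
   = normal_pdf 0 c s * normal_pdf (a * s / c ^+ 2) (b / c) x)%R.
Proof.
move=> b0 c.
have c2 : (c ^+ 2 = a ^+ 2 + b ^+ 2)%R by rewrite sqr_sqrtr// addr_ge0 ?sqr_ge0.
have b2 : (0 < b ^+ 2)%R by rewrite exprn_even_gt0.
have c20 : (0 < c ^+ 2)%R by rewrite c2 ltr_wpDl// sqr_ge0.
have c0 : (c != 0)%R by rewrite -sqrf_eq0 gt_eqF.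
have bc0 : (b / c != 0)%R by rewrite mulf_neq0// invr_neq0.
rewrite !normal_pdfE ?oner_neq0// /normal_peak /normal_fun.
rewrite mulrACA [RHS]mulrACA; congr (_ * _)%R.
  have pi2 : (0 <= pi :> R)%R by exact: pi_ge0.
  rewrite -!invfM -!sqrtrM ?mulrn_wge0 ?mulr_ge0 ?sqr_ge0 ?sqrtr_ge0//.
  by congr (_^-1)%R; congr (Num.sqrt _); field.
rewrite -!expRD; congr expR; rewrite exprMn exprVn c2; field.
by rewrite -c2 gt_eqF.
Qed.

(* Completing the square: integrate out [x] first. *)
Lemma normal_prob_conv (a b : R) (A : set R) : (0 <= a)%R -> measurable A ->
  \int[normal_prob 0 1]_x normal_prob 0 1 ((fun y => a * x + b * y)%R @^-1` A)
  = normal_prob 0 1 ((fun z => Num.sqrt (a ^+ 2 + b ^+ 2) * z)%R @^-1` A).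
Proof.
(* For [b = 0] the inner law is the point mass at [a * x], which has no density. *)
move=> a0 mA; have [->|b0] := eqVneq b 0%R.
  rewrite expr0n/= addr0 sqrtr_sqr ger0_norm//.
  have maA : measurable ((fun z => a * z)%R @^-1` A).
    by rewrite -[X in measurable X]setTI; apply: measurable_funM.
  rewrite -[X in _ = normal_prob 0 1 X]setIT -integral_indic//.
  apply: eq_integral => x _.
  have -> : (fun y => a * x + 0 * y)%R @^-1` A = [set y | (a * x)%R \in A].
    by apply/seteqP; split => y /=; rewrite mul0r addr0 inE.
  rewrite indicE (_ : (x \in _) = (a * x \in A)%R)//.
  case: (_ \in A).
    by rewrite (_ : [set _ | _] = setT) ?probability_setT//; apply/seteqP; split.
  by rewrite (_ : [set _ | _] = set0) ?measure0//; apply/seteqP; split.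
set c := Num.sqrt _.
have b2 : (0 < b ^+ 2)%R by rewrite exprn_even_gt0.
have c0 : (c != 0)%R by rewrite gt_eqF// sqrtr_gt0 ltr_wpDl// sqr_ge0.
have bc0 : (b / c != 0)%R by rewrite mulf_neq0// invr_neq0.
pose TR := measurableTypeR R.
have mpdf2 : measurable_fun [set: TR * TR]
    (fun z : TR * TR => normal_pdf (a * z.1) b z.2).
  rewrite (_ : (fun z => _) = (fun z : TR * TR =>
      normal_peak b * expR (- (z.2 - a * z.1) ^+ 2 / (b ^+ 2 *+ 2)))%R); last first.
    by apply/funext => z; rewrite normal_pdfE.
  apply: measurable_funM => //; apply: measurableT_comp => //.
  apply: measurable_funM => //; apply: measurableT_comp => //.
  apply: measurable_funX; apply: measurable_funB => //.
  exact: measurable_funM.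
pose F0 (z : TR * TR) := (normal_pdf (a * z.1) b z.2)%:E * (\1_A z.2)%:E.
have mF0 : measurable_fun [set: TR * TR] F0.
  apply: emeasurable_funM; first exact/measurable_EFinP.
  have m1A : measurable_fun [set: TR] (\1_A : TR -> R).
    exact: measurable_indic.
  have := measurableT_comp m1A (@measurable_snd _ _ TR TR).
  by move/measurable_EFinP.
have F00 z : 0 <= F0 z by rewrite mule_ge0 ?lee_fin// normal_pdf_ge0.
pose F (z : TR * TR) := (normal_pdf 0 1 z.1)%:E * F0 z.
have G_E x : normal_prob 0 1 ((fun y => a * x + b * y)%R @^-1` A)
    = \int[mu]_s F0 (x, s).
  rewrite normal_prob_affine// /normal_prob integral_mkcond.
  by apply: eq_integral => s _; rewrite epatch_indic.
have mpdf m s : measurable_fun [set: TR] (normal_pdf m s : TR -> R).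
  exact: measurable_normal_pdf.
transitivity (\int[mu]_x \int[mu]_s F (x, s)).
  transitivity (\int[mdensity mu (mpdf 0%R 1%R) (normal_pdf_ge0 0 1)]_x
     (\int[mu]_s F0 (x, s))).
    under eq_integral do rewrite G_E.
    exact: eq_measure_integral.
  rewrite ge0_integral_mdensity; last 2 first.
  - exact: (@measurable_fun_fubini_tonelli_F _ _ TR TR R mu F0).
  - by move=> x; apply: integral_ge0 => s _; exact: F00.
  apply: eq_integral => x _; rewrite muleC -ge0_integralZl//.
  - exact: measurableT_comp mF0 (measurable_pair1 _).
  - by rewrite lee_fin normal_pdf_ge0.
transitivity (\int[mu]_s \int[mu]_x F (x, s)).
  apply: (@fubini_tonelli _ _ TR TR R mu mu F).
  - apply: emeasurable_funM => //; apply/measurable_EFinP.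
    exact: (measurableT_comp (mpdf 0%R 1%R)).
  - by move=> x; rewrite mule_ge0// lee_fin normal_pdf_ge0.
transitivity (normal_prob 0 c A); last first.
  rewrite -normal_prob_affine//; congr (normal_prob 0 1 _).
  by apply/funext => z /=; rewrite add0r.
rewrite /normal_prob [RHS]integral_mkcond; apply: eq_integral => s _.
under eq_integral => x _.
  rewrite /F /F0 /= muleA -EFinM (normal_pdf_mul a x s b0) -/c.
  rewrite mulrAC EFinM; over.
rewrite ge0_integralZl//; last 3 first.
- exact/measurable_EFinP.
- by move=> x _; rewrite lee_fin normal_pdf_ge0.
- by rewrite lee_fin mulr_ge0// normal_pdf_ge0.
by rewrite integral_normal_pdf mule1 epatch_indic.
Qed.
End gauss.

(** * Cylinder sets of a finite family of random variables *)

Section cylinders.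
Context d (T : measurableType d) (R : realType) (J : finType).
Variable Z : J -> T -> R.
Hypothesis mZ : forall j, measurable_fun setT (Z j).
Implicit Types Q : pred J.

Definition rect (A : J -> set R) : set T := \bigcap_(j in setT) Z j @^-1` A j.

(** A pi-system generating the sigma-algebra of the [Z j] with [Q j]. Rectangles stay indexed by all
    of [J], so independence of the whole family applies to them directly. *)
Definition cylinders Q : set (set T) :=
  [set rect A | A in [set A | (forall j, measurable (A j)) /\
                              forall j, ~~ Q j -> A j = setT]].

Lemma measurable_rect A : (forall j, measurable (A j)) -> measurable (rect A).
Proof.
move=> mA; apply: fin_bigcap_measurable; first exact: finite_finset.
by move=> j _; rewrite -[X in measurable X]setTI; exact: mZ.
Qed.

Lemma cylinders_measurable Q : cylinders Q `<=` measurable.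
Proof. by move=> _ [A [mA _] <-]; exact: measurable_rect. Qed.

Lemma cylinders_setI Q : setI_closed (cylinders Q).
Proof.
move=> _ _ [A [mA QA] <-] [B [mB QB] <-].
exists (fun j => A j `&` B j).
  by split=> [j|j Qj]; [exact: measurableI|rewrite QA// QB// setIT].
apply/seteqP; split=> [w AB|w [Aw Bw] j _].
  by split=> j _; have [] := AB j I.
by split; [exact: Aw|exact: Bw].
Qed.

Lemma cylinders_setT Q : cylinders Q setT.
Proof.
by exists (fun=> setT); [split|apply/seteqP; split].
Qed.

Lemma cylinders_preimage Q j (A : set R) : Q j -> measurable A ->
  cylinders Q (Z j @^-1` A).
Proof.
move=> Qj mA; exists (fun i => if i == j then A else setT).
  split=> [i|i Qi]; first by case: ifP.
  by case: eqP => // ij; rewrite ij Qj in Qi.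
apply/seteqP; split=> [w /(_ j I)|w Aw i _] /=; first by rewrite eqxx.
by case: eqP => // ->.
Qed.

Lemma cylinders_measurable_fun Q j : Q j ->
  measurable_fun [set: g_sigma_algebraType (cylinders Q)] (Z j).
Proof.
move=> Qj _ A mA; rewrite setTI; apply: sub_sigma_algebra.
exact: cylinders_preimage.
Qed.

Lemma cylinders_measurable_sum Q (c : J -> R) (s : seq J) : {in s, forall j, Q j} ->
  measurable_fun [set: g_sigma_algebraType (cylinders Q)]
    (fun w => \sum_(j <- s) Z j w * c j).
Proof.
pose TQ : measurableType _ := g_sigma_algebraType (cylinders Q).
elim: s => [_|j s IH sQ].
  rewrite (_ : (fun _ => _) = cst 0); first exact: (@measurable_cst _ _ TQ).
  by apply/funext => w; rewrite big_nil.
under eq_fun do rewrite big_cons.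
apply: (@measurable_funD _ TQ); last first.
  by apply: IH => i si; apply: sQ; rewrite inE si orbT.
apply: (@measurable_funM _ TQ) => //.
by apply: cylinders_measurable_fun; apply: sQ; rewrite inE eqxx.
Qed.

End cylinders.

(** * Linear combinations of independent standard normal variables *)

Section gaussian_vector.
Context d (T : measurableType d) (R : realType) (P : probability T R) (J : finType).
Variable Z : J -> T -> R.
Hypothesis mZ : forall j, measurable_fun setT (Z j).
Hypothesis Zindep : forall A : J -> set R, (forall j, measurable (A j)) ->
  P (rect Z A) = (\prod_j P (Z j @^-1` A j))%E.
Hypothesis Znormal : forall j (A : set R), measurable A ->
  P (Z j @^-1` A) = normal_prob 0 1 A.

Lemma measurable_preimage_Z j (A : set R) : measurable A -> measurable (Z j @^-1` A).
Proof. by move=> mA; rewrite -[X in measurable X]setTI; exact: mZ. Qed.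

Lemma cylinders_indep (j : J) (B : set R) (S : T -> R) (A : set R) :
  measurable_fun [set: g_sigma_algebraType (cylinders Z (predC1 j))] S ->
  measurable A -> measurable B ->
  P (S @^-1` A `&` Z j @^-1` B) = (P (S @^-1` A) * P (Z j @^-1` B))%E.
Proof.
move=> mS mA mB.
set G := cylinders Z (predC1 j).
have mSA : measurable (S @^-1` A).
  rewrite -[X in measurable X]setTI.
  by apply: (sub_g_sigma_measurable_fun (@cylinders_measurable _ _ _ _ _ mZ _) mS).
have mZB := measurable_preimage_Z j mB.
have Pfin : P (Z j @^-1` B) \is a fin_num by exact: fin_num_measure.
have E : (\int[P]_w ((\1_(S @^-1` A) w)%:E * (\1_(Z j @^-1` B) w)%:E)
    = \int[P]_w ((\1_(S @^-1` A) w)%:E * (fine (P (Z j @^-1` B)))%:E))%E.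
  apply: (@eq_integral_pi_system _ T R P G).
  - exact: cylinders_measurable.
  - exact: cylinders_setI.
  - exact: cylinders_setT.
  - exact: measurable_indic.
  - by [].
  - by [].
  - by move=> w; rewrite fine_ge0.
  - by rewrite integral_indic// setIT; exact: le_lt_trans (probability_le1 _ _) (ltry _).
  - move=> _ [C [mC Cj] <-].
    have mrC := measurable_rect mZ mC.
    rewrite integral_indic//= integral_cst//= fineK//.
    pose C' i := if i == j then B else C i.
    have -> : Z j @^-1` B `&` rect Z C = rect Z C'.
      apply/seteqP; split=> [w [Bw Cw] i _|w Cw]; rewrite /C'.
        by case: eqP => [->//|_]; exact: Cw.
      split; first by have := Cw j I; rewrite /C' eqxx.
      move=> i _; have := Cw i I; rewrite /C'; case: eqP => // -> _.
      by rewrite Cj//= negbK.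
    rewrite !Zindep//; last by move=> i; rewrite /C'; case: eqP.
    rewrite (bigD1 j)//= [in RHS](bigD1 j)//= /C' eqxx Cj ?negbK//= preimage_setT.
    rewrite probability_setT mul1e; congr (_ * _)%E.
    by apply: eq_bigr => i /negbTE ->.
  - apply/measurable_EFinP.
    apply: (@measurable_indic _ (g_sigma_algebraType G)).
    by rewrite -[X in measurable X]setTI; exact: mS.
  - by move=> w; rewrite lee_fin.
transitivity (\int[P]_w ((\1_(S @^-1` A) w)%:E * (\1_(Z j @^-1` B) w)%:E))%E.
  under eq_integral do rewrite -EFinM.
  rewrite -[X in P X]setIT -integral_indic//; last exact: measurableI.
  by apply: eq_integral => w _; rewrite indicI.
rewrite E ge0_integralZr//.
- by rewrite integral_indic// setIT fineK.
- exact/measurable_EFinP.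
- by rewrite lee_fin fine_ge0.
Qed.

(** Induction on [s]: the partial sum is independent of the next variable, and [normal_prob_conv]
    adds the two. The law is a scaled standard normal rather than a [normal_prob] with that
    deviation, so that a zero deviation gives the point mass at 0. *)
Lemma normal_sum (c : J -> R) (s : seq J) (A : set R) : uniq s -> measurable A ->
  P ((fun w => \sum_(j <- s) Z j w * c j) @^-1` A)
  = normal_prob 0 1 ((fun z => Num.sqrt (\sum_(j <- s) c j ^+ 2) * z) @^-1` A).
Proof.
elim: s A => [A _ mA|j s IH A /= /andP[js us] mA].
  rewrite big_nil sqrtr0.
  have [A0|A0] := pselect (A 0).
    rewrite (_ : _ @^-1` A = setT) ?probability_setT; last first.
      by apply/seteqP; split => w //= _; rewrite big_nil.
    rewrite (_ : _ @^-1` A = setT) ?probability_setT//.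
    by apply/seteqP; split => w //= _; rewrite mul0r.
  rewrite (_ : _ @^-1` A = set0) ?measure0; last first.
    by apply/seteqP; split => w //=; rewrite big_nil.
  rewrite (_ : _ @^-1` A = set0) ?measure0//.
  by apply/seteqP; split => w //=; rewrite mul0r.
set S := fun w => \sum_(j <- s) Z j w * c j.
set g := Num.sqrt (\sum_(j <- s) c j ^+ 2).
have mS : measurable_fun [set: g_sigma_algebraType (cylinders Z (predC1 j))] S.
  apply: cylinders_measurable_sum => i si /=.
  by apply: contraNneq js => <-.
have mST : measurable_fun [set: T] S.
  exact: (sub_g_sigma_measurable_fun (@cylinders_measurable _ _ _ _ _ mZ _) mS).
pose TR := measurableTypeR R.
pose N : probability TR R := normal_prob 0 1.
pose phi1 w : TR * TR := (S w, Z j w).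
pose phi2 (z : TR * TR) : TR * TR := (g * z.1, z.2).
have mphi1 : measurable_fun [set: T] phi1.
  by apply: (@measurable_fun_pair _ _ _ T TR TR); [exact: mST|exact: mZ].
have mphi2 : measurable_fun [set: TR * TR] phi2.
  by apply: measurable_fun_pair => //; exact: measurable_funM.
(* The joint law of the partial sum and [Z j] is identified on product sets, which form a generating
   pi-system. *)
have law (X : set (TR * TR)) : measurable X ->
    P (phi1 @^-1` X) = (N \x N)%E (phi2 @^-1` X).
  pose C : set (set (TR * TR)) :=
    [set A `*` B | A in measurable & B in measurable].
  apply: (@measure_unique _ R _ C (fun=> setT) _ _ _ _
      (pushforward P phi1) (pushforward (N \x N)%E phi2)) => //.
  - exact: measurable_prod_measurableType.
  - move=> _ _ [A1 mA1 [B1 mB1 <-]] [A2 mA2 [B2 mB2 <-]].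
    exists (A1 `&` A2); first exact: measurableI.
    by exists (B1 `&` B2); [exact: measurableI|rewrite setXI].
  - by move=> _; exists setT => //; exists setT => //; rewrite setXTT.
  - by rewrite bigcup_const.
  - move=> _ [A1 mA1 [B1 mB1 <-]]; rewrite /pushforward.
    transitivity (P (S @^-1` A1 `&` Z j @^-1` B1)) => //.
    rewrite cylinders_indep// Znormal// IH//.
    transitivity ((N \x N)%E (((fun z => g * z) @^-1` A1 : set TR) `*` B1)) => //.
    rewrite product_measure1E//.
    by rewrite -[X in measurable X]setTI; apply: (@measurable_funM _ TR).
  - by move=> _; exact: (le_lt_trans (probability_le1 P measurableT) (ltry _)).
pose X := [set z : TR * TR | A (z.1 + z.2 * c j)].
have mX : measurable X.
  rewrite -[X in measurable X]setTI.
  have : measurable_fun [set: TR * TR] (fun z : TR * TR => z.1 + z.2 * c j : TR).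
    by apply: measurable_funD => //; exact: measurable_funM.
  by apply.
transitivity (P (phi1 @^-1` X)).
  congr (P _); apply/seteqP; split=> w; rewrite /X/= big_cons addrC//.
rewrite law//.
transitivity (\int[N]_x normal_prob 0 1 ((fun y => g * x + c j * y)%R @^-1` A))%E.
  apply: eq_integral => x _ /=; congr (normal_prob 0 1 _).
  apply/seteqP; split=> y /=; rewrite /xsection/= inE /X /=; by rewrite [c j * _]mulrC.
rewrite normal_prob_conv//; last exact: sqrtr_ge0.
congr (normal_prob 0 1 _); apply/funext => z /=; congr (A (Num.sqrt _ * _)).
by rewrite big_cons addrC sqr_sqrtr// sumr_ge0// => i _; exact: sqr_ge0.
Qed.

End gaussian_vector.

(** * The number of misclassified points *)

Section sstar.
Context {R : realType} (n d : nat).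
Implicit Types (x : 'I_n -> 'I_d -> R) (y : 'I_n -> R) (u : 'rV[R]_d.+1).

Definition xbar (x : 'I_d -> R) (k : 'I_d.+1) : R :=
  if unlift ord0 k is Some j then x j else 1.

Lemma xbar_dotE (x : 'I_d -> R) u : xbar_dot x u = \sum_k xbar x k * u ord0 k.
Proof.
rewrite big_ord_recl /xbar unlift_none mul1r; congr (_ + _).
by apply: eq_bigr => j _; rewrite liftK.
Qed.

(** A countable family of directions, not normalised: positive scaling does not change which points
    are misclassified. *)
Definition ratv (q : {ffun 'I_d.+1 -> rat}) : 'rV[R]_d.+1 := \row_k ratr (q k).

Lemma xbar_dotZ (x : 'I_d -> R) a u : xbar_dot x (a *: u) = a * xbar_dot x u.
Proof.
rewrite !xbar_dotE mulr_sumr; apply: eq_bigr => k _.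
by rewrite mxE mulrCA.
Qed.

Lemma bad_countE x y u :
  bad_count x y u = \sum_i \1_(`]-oo, 0]) (y i * xbar_dot (x i) u).
Proof.
rewrite /bad_count -sum1_card natr_sum big_mkcond; apply: eq_bigr => i _.
rewrite indicE mem_setE in_itv/=; case: ifPn => [/set_mem/= ->//|].
by case: (leP (y i * _) 0) => // yi /negP[]; exact/mem_set.
Qed.

Lemma bad_count_le x y u u' :
  (forall i, 0 < y i * xbar_dot (x i) u -> 0 < y i * xbar_dot (x i) u') ->
  bad_count x y u' <= bad_count x y u.
Proof.
move=> h; rewrite ler_nat; apply/subset_leq_card/fintype.subsetP => i.
move=> /set_mem /= ui; apply/mem_set => /=; move: ui.
by rewrite !leNgt; apply: contra; exact: h.
Qed.

Lemma bad_count_rat x y u : exists q, bad_count x y (ratv q) <= bad_count x y u.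
Proof.
pose v i k := y i * xbar (x i) k.
have vE i u' : y i * xbar_dot (x i) u' = \sum_k v i k * u' ord0 k.
  by rewrite xbar_dotE mulr_sumr; apply: eq_bigr => k _; rewrite mulrA.
(* [M] exceeds every row sum of [|v i k|], and [e] is the least positive margin, capped at 1. An
   error below [e / M] in each coordinate moves every margin by less than [e]. *)
pose M := 1 + \sum_i \sum_k `|v i k|.
have M0 : 0 < M by rewrite ltr_pwDl// sumr_ge0// => i _; rewrite sumr_ge0.
pose e := \big[Num.min/1]_(i | 0 < \sum_k v i k * u ord0 k) \sum_k v i k * u ord0 k.
have e0 : 0 < e by exact: lt_bigmin.
have qP k : exists r : rat, `|u ord0 k - ratr r| < e / M.
  have /rat_in_itvoo[r] : u ord0 k - e / M < u ord0 k + e / M.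
    by rewrite ltrD2l gtrN// divr_gt0.
  rewrite in_itv/= => /andP[h1 h2]; exists r.
  by rewrite ltr_norml; apply/andP; split; lra.
have [q qE] := choice qP.
exists [ffun k => q k]; apply: bad_count_le => i; rewrite !vE => ui.
have ei : e <= \sum_k v i k * u ord0 k by exact: bigmin_le_cond.
have : `|\sum_k v i k * u ord0 k - \sum_k v i k * ratv [ffun k => q k] ord0 k| < e.
  rewrite -sumrB (le_lt_trans (ler_norm_sum _ _ _))//.
  apply: (@le_lt_trans _ _ (\sum_k `|v i k| * (e / M))).
    apply: ler_sum => k _; rewrite -mulrBr normrM ler_wpM2l//.
    by rewrite mxE ffunE ltW.
  rewrite -mulr_suml mulrA ltr_pdivrMr// mulrC ltr_pM2l//.
  have r0 : 0 <= \sum_(j | j != i) \sum_k `|v j k|.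
    by rewrite sumr_ge0// => j _; rewrite sumr_ge0.
  by rewrite /M (bigD1 i)//=; lra.
by rewrite ltr_norml => /andP[_]; lra.
Qed.

Lemma sphere_neq0 : (@sphere R d) !=set0.
Proof.
exists (\row_k (k == ord0)%:R); rewrite /sphere/= (bigD1 ord0)//= mxE eqxx expr1n.
by rewrite big1 ?addr0// => k /negbTE k0; rewrite mxE k0 expr0n.
Qed.

(** A nonzero vector is rescaled to unit length. The zero vector misclassifies every point, so any
    unit vector does at least as well. *)
Lemma bad_count_sphere x y u : exists2 u', sphere u' & bad_count x y u' <= bad_count x y u.
Proof.
have [u0|u0] := eqVneq u 0.
  have [u' su'] := sphere_neq0; exists u' => //; apply: bad_count_le => i.
  by rewrite u0 -(scale0r u) xbar_dotZ mul0r mulr0 ltxx.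
pose N := \sum_k (u ord0 k) ^+ 2.
have N0 : 0 < N.
  rewrite lt0r sumr_ge0 ?andbT; last by move=> k _; exact: sqr_ge0.
  apply: contra u0; rewrite psumr_eq0; last by move=> k _; exact: sqr_ge0.
  move=> /allP h; apply/eqP/rowP => k; rewrite mxE; apply/eqP.
  by have := h k; rewrite mem_index_enum sqrf_eq0; exact.
exists ((Num.sqrt N)^-1 *: u).
  rewrite /sphere/=; under eq_bigr do rewrite mxE exprMn.
  by rewrite -mulr_sumr exprVn sqr_sqrtr ?(ltW N0)// mulVf// gt_eqF.
apply: bad_count_le => i ui; rewrite xbar_dotZ mulrCA mulr_gt0// invr_gt0.
by rewrite sqrtr_gt0.
Qed.

(* Strict inequalities survive small perturbations, so rational directions
   already attain every value below the infimum. *)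
Lemma le_sstarP x y (c : R) :
  c <= sstar x y <-> forall q, c <= bad_count x y (ratv q).
Proof.
split=> [cs q|cq].
  have [u su uq] := bad_count_sphere x y (ratv q).
  (* Counts are bounded below by 0 and the sphere is nonempty, so [inf] is a genuine infimum in both
     directions. *)
  apply: (le_trans cs); apply: le_trans uq; apply: ge_inf; last by exists u.
  by exists 0 => _ [u' _ <-].
apply: lb_le_inf; first by have [u su] := sphere_neq0; exists (bad_count x y u); exists u.
by move=> _ [u _ <-]; have [q] := bad_count_rat x y u; exact: le_trans.
Qed.

End sstar.

(** * Measurability through rational directions *)

Definition halfspace_pattern (T : Type) (R : realType) (n d : nat)
    (X : 'I_n -> 'I_d -> T -> R) (A : {set 'I_n}) : set T :=
  \bigcup_(q in setT) \bigcap_(i in setT)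
    [set w | (0 < xbar_dot (X i ^~ w) (ratv q)) = (i \in A)].

Section measurability.
Context dT (T : measurableType dT) {R : realType} (n d : nat).
Variables (X : 'I_n -> 'I_d -> T -> R) (mX : forall i j, measurable_fun setT (X i j)).

Lemma measurable_xbar_dot i (u : 'rV[R]_d.+1) :
  measurable_fun setT (fun w => xbar_dot (X i ^~ w) u).
Proof.
apply: measurable_funD => //; apply: measurable_sum => j.
exact: measurable_funM.
Qed.

(** The union over rational directions is countable. Only the covariates have to be measurable, so
    the lemma also applies to the sigma-algebra that they generate. *)
Lemma measurable_halfspace_pattern A : measurable (halfspace_pattern X A).
Proof.
apply: countable_bigcupT_measurable; first exact: countableP.
move=> q; apply: fin_bigcap_measurable; first exact: finite_finset.
move=> i _; have mi := measurable_xbar_dot i (ratv q).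
case: (i \in A).
  rewrite (_ : [set _ | _] = setT `&` (fun w => xbar_dot (X i ^~ w) (ratv q)) @^-1` `]0, +oo[).
    exact: mi.
  by rewrite setTI; apply/seteqP; split => w /=; rewrite in_itv/= andbT.
rewrite (_ : [set _ | _] = setT `&` (fun w => xbar_dot (X i ^~ w) (ratv q)) @^-1` `]-oo, 0]).
  exact: mi.
by rewrite setTI; apply/seteqP; split => w /=; rewrite in_itv/= leNgt; [move=> ->|move/negbTE].
Qed.

Lemma measurable_le_sstar (Y : 'I_n -> T -> R) (c : R) :
  (forall i, measurable_fun setT (Y i)) ->
  measurable [set w | c <= sstar (fun i j => X i j w) (Y ^~ w)].
Proof.
move=> mY.
have -> : [set w | c <= sstar (fun i j => X i j w) (Y ^~ w)] =
    \bigcap_(q in [set: {ffun 'I_d.+1 -> rat}])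
      [set w | c <= bad_count (fun i j => X i j w) (Y ^~ w) (ratv q)].
  apply/seteqP; split => w /=; rewrite le_sstarP; first by move=> h q _; exact: h.
  by move=> h q; exact: h.
rewrite -[X in measurable X]setCK setC_bigcap; apply: measurableC.
apply: countable_bigcupT_measurable; first exact: countableP.
move=> q; apply: measurableC.
rewrite (_ : [set _ | _] = setT `&`
  (fun w => \sum_i \1_(`]-oo, 0]) (Y i w * xbar_dot (X i ^~ w) (ratv q)))
    @^-1` `[c, +oo[).
  have mb : measurable_fun setT
      (fun w => \sum_i (\1_(`]-oo, 0]) (Y i w * xbar_dot (X i ^~ w) (ratv q)) : R)).
    apply: measurable_sum => i; apply: measurableT_comp => //.
    by apply: measurable_funM => //; exact: measurable_xbar_dot.
  exact: mb.
rewrite setTI; apply/seteqP; split => w /=; rewrite in_itv/= andbT bad_countE//.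
Qed.
End measurability.

(** * The normal distribution function *)

Section Phi.
Context {R : realType}.
Implicit Types t : R.

Lemma Phi_fin t : (Phi t)%:E = normal_prob 0 1 `]-oo, t].
Proof. by rewrite /Phi fineK//; exact: fin_num_measure. Qed.

Lemma Phi_ge0 t : 0 <= Phi t.
Proof. by rewrite -lee_fin Phi_fin measure_ge0. Qed.

Lemma Phi_le1 t : Phi t <= 1.
Proof. by rewrite -lee_fin Phi_fin probability_le1. Qed.

Lemma Phi_nondecreasing : {homo (@Phi R) : s t / s <= t}.
Proof.
move=> s t st; rewrite -lee_fin !Phi_fin; apply: le_measure; rewrite ?inE//.
by move=> z /=; rewrite !in_itv/= => /le_trans; exact.
Qed.

Lemma measurable_Phi : measurable_fun setT (@Phi R).
Proof. by apply: nondecreasing_measurable => //; exact: Phi_nondecreasing. Qed.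

(** Slope -1 in the affine change of variables produces deviation -1, and the density depends on the
    deviation only through its square. *)
Lemma normal_prob_opp (A : set R) : measurable A ->
  normal_prob 0 1 (-%R @^-1` A) = normal_prob 0 1 A.
Proof.
move=> mA; have := @normal_prob_affine R 0 (-1) A; rewrite oppr_eq0 oner_eq0.
move=> /(_ isT mA) E; transitivity (normal_prob 0 (-1) A).
  rewrite -E; congr (normal_prob 0 1 _).
  by apply/funext => z /=; rewrite add0r mulN1r.
apply: eq_integral => z _; congr EFin.
by rewrite !normal_pdfE ?oppr_eq0 ?oner_eq0// /normal_peak /normal_fun sqrrN.
Qed.

(** Reflection turns the lower tail at [- t] into the upper tail from [t], which meets the lower
    tail at [t] in a null set. *)
Lemma Phi_opp_le t : Phi (- t) <= 1 - Phi t.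
Proof.
rewrite lerBrDr -lee_fin EFinD !Phi_fin.
rewrite -(@normal_prob_opp `]-oo, - t])//.
have -> : -%R @^-1` `]-oo, - t] = `[t, +oo[%classic :> set R.
  by apply/seteqP; split => z /=; rewrite !in_itv/= andbT lerN2.
have -> : `[t, +oo[%classic = [set t] `|` `]t, +oo[%classic :> set R.
  by rewrite setU1itv.
have t0 : normal_prob 0 1 [set t] = 0%E.
  have /null_content_dominatesP dom := normal_prob_dominates (0 : R) 1.
  by apply: dom => //; exact: lebesgue_measure_set1.
rewrite (le_trans (leeD2r _ (measureU2 _ _ _)))//.
rewrite [X in (X + _ + _)%E]t0 add0e -measureU//.
- exact: probability_le1 (measurableU _ _ _ _).
- apply/seteqP; split => z //= -[]; rewrite !in_itv/= andbT => /lt_le_trans h /h.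
  by rewrite ltxx.
Qed.

Lemma Phi_abs_le t : Phi (- `|t|) <= Phi t /\ Phi (- `|t|) <= 1 - Phi t.
Proof.
split; first by apply: Phi_nondecreasing; have := ler_norm (- t); rewrite normrN; lra.
by apply: le_trans (Phi_opp_le t); apply: Phi_nondecreasing; rewrite lerN2 ler_norm.
Qed.

End Phi.

(** * The tail bound *)

(** With the covariates fixed, the vectors [xbar] live in dimension [d + 1], so the realised
    patterns shatter only sets of at most [d + 1] points; Sauer-Shelah then bounds their number. *)
Lemma halfspace_pattern_count (T : Type) (R : realType) (n d : nat)
    (X : 'I_n -> 'I_d -> T -> R) (w : T) : (d < n)%N ->
  \sum_(A : {set 'I_n}) (\1_(halfspace_pattern X A) w : R)
    <= (expR 1 * n%:R / d.+1%:R) ^+ d.+1.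
Proof.
move=> dn.
pose F := [set A : {set 'I_n} | w \in halfspace_pattern X A]%SET.
have -> : \sum_(A : {set 'I_n}) (\1_(halfspace_pattern X A) w : R) = #|F|%:R.
  rewrite -sum1_card natr_sum big_mkcond [RHS]big_mkcond; apply: eq_bigr => A _.
  by rewrite indicE inE; case: (_ \in _).
apply: le_trans (sum_bin_le R _); last by rewrite /= dn.
rewrite ler_nat -card_sets_le (leq_trans (card_le_shatters F))//.
apply/subset_leq_card/fintype.subsetP => S; rewrite !inE.
apply: (@halfspace_shatters_card R _ _ (fun i => xbar (X i ^~ w))) => A.
rewrite inE => /set_mem[q _ qA]; exists (fun k => ratr (q k)) => i.
rewrite -(qA i I) xbar_dotE; congr (0 < _); apply: eq_bigr => k _.
by rewrite mxE.
Qed.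

(** * Exponential moment of the disagreements with a fixed pattern *)

Section labels.
Context {R : realType} (n : nat).
Implicit Types (s : {ffun 'I_n -> bool}) (A : {set 'I_n}).

Definition sgnb (b : bool) : R := if b then 1 else -1.

Lemma cond_prob_sgnb b t : cond_prob (sgnb b) t = if b then Phi t else 1 - Phi t.
Proof.
by case: b; rewrite /cond_prob /sgnb ?eqxx// eq_sym -subr_eq0 opprK (@pnatr_eq0 R 2).
Qed.

Definition hamming s A : nat := \sum_i (s i != (i \in A)).

(** By distributivity the sum over all labellings is a product of two-term sums. Each equals
    [1 - (1 - expR (- l)) * q], where [q] is the probability of disagreement at that point, bounded
    below by [Phi_abs_le]. *)
Lemma sum_labels_le (l : R) (t : 'I_n -> R) A : 0 <= l ->
  \sum_s expR (- (l * (hamming s A)%:R)) * \prod_i cond_prob (sgnb (s i)) (t i)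
    <= \prod_i (1 - (1 - expR (- l)) * Phi (- `|t i|)).
Proof.
move=> l0.
pose f i (b : bool) := expR (- (l * (b != (i \in A))%:R)) * cond_prob (sgnb b) (t i).
have f0 i b : 0 <= f i b.
  rewrite mulr_ge0 ?expR_ge0// cond_prob_sgnb; case: b; first exact: Phi_ge0.
  by rewrite subr_ge0 Phi_le1.
rewrite (eq_bigr (fun s : {ffun 'I_n -> bool} => \prod_i f i (s i))); last first.
  move=> s _; rewrite big_split /= -expR_sum; congr (expR _ * _).
  by rewrite /hamming natr_sum mulr_sumr -sumrN.
rewrite -(bigA_distr_bigA f); apply: ler_prod => i _.
rewrite sumr_ge0//=.
have [h1 h2] := Phi_abs_le (t i).
have e1 : expR (- l) <= 1 by rewrite -[leRHS]expR0 ler_expR oppr_le0.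
rewrite big_bool /f !cond_prob_sgnb; case: (i \in A) => /=.
  by rewrite mulr0 mulr1 oppr0 expR0; nra.
by rewrite mulr0 mulr1 oppr0 expR0; nra.
Qed.

End labels.

(** * The probit model and its exponential Markov bound *)

Section model.
Context (R : realType) (dT : measure_display) (T : measurableType dT).
Variables (P : probability T R) (n d : nat).
Variables (X : 'I_n -> 'I_d -> T -> R) (beta0 : R) (beta : 'I_d -> R).
Hypothesis mX : forall i j, measurable_fun setT (X i j).
Hypothesis Xindep : forall A : 'I_n -> 'I_d -> set R, (forall i j, measurable (A i j)) ->
  P (\bigcap_(i in [set: 'I_n]) \bigcap_(j in [set: 'I_d]) (X i j @^-1` A i j))
  = (\prod_(i < n) \prod_(j < d) P (X i j @^-1` A i j))%E.
Hypothesis Xnormal : forall i j (A : set R), measurable A ->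
  P (X i j @^-1` A) = normal_prob 0 1 A.

Let Z (p : 'I_n * 'I_d) := X p.1 p.2.
Let mZ p : measurable_fun setT (Z p). Proof. exact: mX. Qed.
Let t i w := lin_pred beta0 beta (X i ^~ w).

Let rectE A : rect Z A =
  \bigcap_(i in [set: 'I_n]) \bigcap_(j in [set: 'I_d]) (X i j @^-1` A (i, j)).
Proof.
by apply/seteqP; split=> [w h i _ j _|w h [i j] _]; [exact: (h (i, j))|exact: h].
Qed.

Let prod_pair (F : 'I_n * 'I_d -> \bar R) :
  (\prod_p F p = \prod_(i < n) \prod_(j < d) F (i, j))%E.
Proof. by rewrite pair_bigA; apply: eq_bigr => -[]. Qed.

Let Zindep A : (forall p, measurable (A p)) ->
  P (rect Z A) = (\prod_p P (Z p @^-1` A p))%E.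
Proof.
by move=> mA; rewrite rectE Xindep// prod_pair.
Qed.

Lemma integral_lin_pred i (g : R -> R) : measurable_fun setT g -> (forall x, 0 <= g x) ->
  (\int[P]_w (g (t i w))%:E = \int[normal_prob 0 1]_z
     (g (beta0 + Num.sqrt (\sum_j beta j ^+ 2) * z))%:E)%E.
Proof.
move=> mg g0.
set c := Num.sqrt _.
pose TR := measurableTypeR R.
pose N : probability TR R := normal_prob 0 1.
pose S w : TR := \sum_j X i j w * beta j.
pose G (x : TR) := (g (beta0 + x))%:E.
have mS : measurable_fun [set: T] S.
  by apply: measurable_sum => j; exact: measurable_funM.
pose cz (z : TR) : TR := c * z.
have mc : measurable_fun [set: TR] cz.
  exact: measurable_funM.
have mG : measurable_fun [set: TR] G.
  apply/measurable_EFinP; apply: measurableT_comp => //.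
  exact: measurable_funD.
have G0 x : (0 <= G x)%E by rewrite lee_fin.
transitivity (\int[P]_w (G \o S) w)%E => //.
transitivity (\int[N]_z (G \o cz) z)%E => //.
rewrite -(ge0_integral_pushforward mS P measurableT mG (fun x _ => G0 x)).
rewrite -(ge0_integral_pushforward mc N measurableT mG (fun x _ => G0 x)).
apply: eq_measure_integral => A mA _.
pose r := [seq (i, j) | j <- index_enum 'I_d].
have ur : uniq r by rewrite map_inj_uniq ?index_enum_uniq// => j j' [].
transitivity (P ((fun w => \sum_(p <- r) Z p w * beta p.2) @^-1` A)).
  by congr (P _); apply/funext => w /=; rewrite big_map.
rewrite (normal_sum mZ Zindep (fun p => Xnormal p.1 p.2) (fun p => beta p.2) ur mA).
by rewrite big_map.
Qed.

(** The predictor [t i] depends on row [i] only, and the cylinders over distinct rows are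
    independent. *)
Lemma integral_prod_lin_pred (g : R -> R) : measurable_fun setT g ->
  (forall x, 0 <= g x <= 1) ->
  (\int[P]_w (\prod_(i < n) g (t i w))%:E = \prod_(i < n) \int[P]_w (g (t i w))%:E)%E.
Proof.
move=> mg g01.
pose Q (i : 'I_n) := [pred p : 'I_n * 'I_d | p.1 == i].
apply: (@integral_prod_indep _ T R P n (fun i => cylinders Z (Q i))).
- by move=> i; exact: cylinders_measurable.
- by move=> i; exact: cylinders_setI.
- by move=> i; exact: cylinders_setT.
- move=> B cB.
  have {}cB i : exists A, [/\ forall p, measurable (A p),
      forall p, ~~ Q i p -> A p = setT & rect Z A = B i].
    by have [A [mA QA] AB] := cB i; exists A.
  have [A AP] := choice cB.
  (* One cylinder per row combines into a single rectangle, whose side at [p] comes from the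
     cylinder of row [p.1]. *)
  have -> : \bigcap_(i in setT) B i = rect Z (fun p => A p.1 p).
    apply/seteqP; split=> [w Bw p _|w Aw i _].
      by have := Bw p.1 I; have [_ _ <-] := AP p.1; apply.
    have [_ QA <-] := AP i; move=> p _; have [pi|pi] := boolP (Q i p).
      by have := Aw p I; rewrite (eqP pi).
    by rewrite QA.
  rewrite Zindep; last by move=> p; have [] := AP p.1.
  rewrite prod_pair /=.
  apply: eq_bigr => i _; have [mA QA <-] := AP i.
  rewrite Zindep// prod_pair /=.
  rewrite [RHS](bigD1 i)//= [X in (_ * X)%E]big1 ?mule1// => i' i'i.
  by rewrite big1// => j _; rewrite QA//= preimage_setT probability_setT.
- move=> i.
  pose TQ : measurableType _ := g_sigma_algebraType (cylinders Z (Q i)).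
  apply: (@measurableT_comp _ _ _ TQ _ _ g) => //.
  apply: (@measurable_funD _ TQ); first exact: (@measurable_cst _ _ TQ).
  rewrite (_ : (fun w => _) = (fun w => \sum_(p <- [seq (i, j) | j <- index_enum 'I_d])
      Z p w * beta p.2)); last by apply/funext => w; rewrite big_map.
  by apply: cylinders_measurable_sum => p /mapP[j _ ->] /=.
- by move=> i w; exact: g01.
Qed.

Variable Y : 'I_n -> T -> R.
Hypothesis mY : forall i, measurable_fun setT (Y i).
Hypothesis Ypm : forall i w, Y i w = 1 \/ Y i w = -1.
Hypothesis Ycond : forall (A : 'I_n -> 'I_d -> set R) (y : 'I_n -> R),
  (forall i j, measurable (A i j)) -> (forall i, y i = 1 \/ y i = -1) ->
  let B := \bigcap_(i in [set: 'I_n]) \bigcap_(j in [set: 'I_d])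
             (X i j @^-1` A i j) in
  P (B `&` [set w | forall i, Y i w = y i])
  = (\int[P]_w (\1_B w * \prod_(i < n)
                  cond_prob (y i) (lin_pred beta0 beta (fun j => X i j w)))%:E)%E.

Definition labelled (s : {ffun 'I_n -> bool}) : set T :=
  [set w | forall i, Y i w = sgnb (s i)].

Lemma measurable_labelled s : measurable (labelled s).
Proof.
rewrite (_ : labelled s = \bigcap_(i in setT) (Y i @^-1` [set sgnb (s i)])); last first.
  by apply/seteqP; split=> w h i; [move=> _; exact: h|exact: h].
apply: fin_bigcap_measurable; first exact: finite_finset.
by move=> i _; rewrite -[X in measurable X]setTI; exact: mY.
Qed.

Lemma measurable_lin_pred i : measurable_fun setT (t i).
Proof.
by apply: measurable_funD => //; apply: measurable_sum => j; exact: measurable_funM.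
Qed.

Let cp (s : {ffun 'I_n -> bool}) w := \prod_(i < n) cond_prob (sgnb (s i)) (t i w).

Let cp0 s w : 0 <= cp s w.
Proof.
apply: prodr_ge0 => i _; rewrite cond_prob_sgnb; case: ifP => _.
  exact: Phi_ge0.
by rewrite subr_ge0 Phi_le1.
Qed.

Let mcp s : measurable_fun setT (cp s).
Proof.
apply: measurable_prod => i _.
rewrite (_ : (fun w => _) = (fun w => if s i then Phi (t i w) else 1 - Phi (t i w))).
  have mPt : measurable_fun setT (fun w => Phi (t i w)).
    by apply: (measurableT_comp measurable_Phi); exact: measurable_lin_pred.
  by case: (s i) => //; exact: measurable_funB.
by apply/funext => w; rewrite cond_prob_sgnb.
Qed.

(** [Ycond] gives the conditional law of the labels on rectangles of covariates, a pi-system; the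
    identity extends to every event generated by the covariates, in particular to half-space
    patterns. *)
Lemma pattern_labelled_prob A s :
  (P (halfspace_pattern X A `&` labelled s)
   = \int[P]_w (\1_(halfspace_pattern X A) w * cp s w)%:E)%E.
Proof.
set H := halfspace_pattern X A.
have mH : measurable H by exact: measurable_halfspace_pattern.
have mL := measurable_labelled s.
rewrite -[X in P X]setIT -integral_indic//; last exact: measurableI.
transitivity (\int[P]_w ((\1_H w)%:E * (\1_(labelled s) w)%:E))%E.
  by apply: eq_integral => w _; rewrite indicI.
transitivity (\int[P]_w ((\1_H w)%:E * (cp s w)%:E))%E => //.
apply: (@eq_integral_pi_system _ T R P (cylinders Z predT)) => //.
- exact: cylinders_measurable.
- exact: cylinders_setI.
- exact: cylinders_setT.
- by rewrite integral_indic// setIT; exact: le_lt_trans (probability_le1 _ _) (ltry _).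
- move=> _ [C [mC _] <-]; rewrite integral_indic//; last exact: measurable_rect.
  transitivity (\int[P]_w (\1_(rect Z C) w * cp s w)%:E)%E.
    rewrite setIC rectE.
    apply: (Ycond (A := fun i j => C (i, j)) (y := fun i => sgnb (s i))) => // i.
    by rewrite /sgnb; case: (s i); [left|right].
  rewrite [RHS]integral_mkcond.
  by apply: eq_integral => w _; rewrite epatch_indic -EFinM mulrC.
- apply/measurable_EFinP.
  apply: (@measurable_indic _ (g_sigma_algebraType (cylinders Z predT))).
  apply: (@measurable_halfspace_pattern _ (g_sigma_algebraType (cylinders Z predT))).
  by move=> i j; exact: (cylinders_measurable_fun (j := (i, j))).
Qed.

(** Union bound and exponential Markov inequality, pointwise: if the infimum is below [c], some
    rational direction has fewer than [c] errors, and the term of its pattern and of the observed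
    labels is at least 1. *)
Lemma pattern_cover (c l : R) w : 0 <= l ->
  \1_(~` [set w | c <= sstar (fun i j => X i j w) (Y ^~ w)]) w
  <= \sum_A \sum_s expR (l * (c - (hamming s A)%:R))
       * (\1_(halfspace_pattern X A `&` labelled s) w : R).
Proof.
move=> l0; rewrite indicE.
have t0 A s : 0 <= expR (l * (c - (hamming s A)%:R))
       * (\1_(halfspace_pattern X A `&` labelled s) w : R).
  by rewrite mulr_ge0 ?expR_ge0.
case: (boolP (w \in _)) => [/set_mem /= wE|_]; last first.
  by apply: sumr_ge0 => A _; apply: sumr_ge0.
have [q qc] : exists q, bad_count (fun i j => X i j w) (Y ^~ w) (ratv q) < c.
  apply: contrapT => /forallNP h; apply: wE; apply/le_sstarP => q.
  by rewrite leNgt; apply/negP/h.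
pose A := [set i : 'I_n | 0 < xbar_dot (X i ^~ w) (ratv q)]%SET.
pose s := [ffun i => Y i w == 1].
have sY i : Y i w = sgnb (s i).
  rewrite /sgnb ffunE; case: (Ypm i w) => ->; rewrite ?eqxx//.
  by case: eqP.
(* Only an inequality holds between disagreements and errors: a point on the hyperplane with label
   -1 counts as misclassified although it agrees with [A]. *)
have hc : (hamming s A)%:R < c.
  apply: le_lt_trans qc; rewrite bad_countE /hamming natr_sum.
  apply: ler_sum => i _; rewrite indicE mem_setE in_itv/= ler_nat sY inE.
  set x := xbar_dot _ _; rewrite /sgnb; case: (s i) => /=.
    by rewrite mul1r leNgt; case: (0 < x).
  by rewrite mulN1r oppr_le0 le_eqVlt; case: (0 < x); rewrite ?orbT.
rewrite (bigD1 A)//= (bigD1 s)//= -addrA.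
rewrite [leLHS](_ : _ = 1 * 1 + 0); last by rewrite mulr1 addr0.
apply: lerD; last by rewrite addr_ge0// !sumr_ge0// => *; rewrite sumr_ge0.
apply: ler_pM => //.
  by rewrite -[leLHS]expR0 ler_expR mulr_ge0// subr_ge0 ltW.
rewrite indicE mem_set//; split=> //.
by exists q => // i _; rewrite /= inE.
Qed.

Lemma sstar_tail_le (c l : R) : (d < n)%N -> 0 <= l ->
  (P (~` [set w | (c <= sstar (fun i j => X i j w) (Y ^~ w))%R])
   <= (expR (l * c) * (expR 1 * n%:R / d.+1%:R) ^+ d.+1
       * (1 - (1 - expR (- l)) * h_const beta0 (Num.sqrt (\sum_j beta j ^+ 2))) ^+ n)%:E)%E.
Proof.
move=> dn l0.
set N0 := (_ ^+ d.+1); set h := h_const _ _.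
have N00 : 0 <= N0 by rewrite exprn_ge0// divr_ge0// mulr_ge0// expR_ge0.
have mE := measurable_le_sstar mX c mY.
have mH A : measurable (halfspace_pattern X A) by exact: measurable_halfspace_pattern.
have mHL A s : measurable (halfspace_pattern X A `&` labelled s).
  by apply: measurableI => //; exact: measurable_labelled.
have e1 : expR (- l) <= 1 by rewrite -[leRHS]expR0 ler_expR oppr_le0.
(* [g (t i w)] is the factor of point [i] in [sum_labels_le]. *)
pose g (x : R) : R := 1 - (1 - expR (- l)) * Phi (- `|x|).
have g01 (x : R) : 0 <= g x <= 1.
  rewrite /g; have := Phi_ge0 (- `|x|); have := Phi_le1 (- `|x|).
  by have := expR_ge0 (- l) => *; apply/andP; split; nra.
have mPhi : measurable_fun setT (fun x : R => Phi (- `|x|)).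
  apply: measurableT_comp; first exact: measurable_Phi.
  by apply: measurableT_comp => //; exact: measurable_normr.
have mg : measurable_fun setT g.
  by apply: measurable_funB => //; exact: measurable_funM.
have gE i : (\int[P]_w (g (t i w))%:E = (1 - (1 - expR (- l)) * h)%:E)%E.
  rewrite integral_lin_pred//; last by move=> x; case/andP: (g01 x).
  set b := Num.sqrt _.
  have mb : measurable_fun [set: R] (fun z => beta0 + b * z).
    by apply: measurable_funD => //; exact: measurable_funM.
  pose r z := Phi (- `|beta0 + b * z|).
  have mr : measurable_fun [set: R] r by exact: (measurableT_comp mPhi mb).
  have r01 z : 0 <= r z <= 1 by rewrite Phi_ge0 Phi_le1.
  have rI : (\int[normal_prob 0%R 1%R]_z (r z)%:E = h%:E)%E.
    by rewrite /h /h_const fineK//; exact: integral01_fin_num.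
  have mgb : measurable_fun [set: R] (fun z => g (beta0 + b * z)).
    exact: (measurableT_comp mg mb).
  have gfin : (\int[normal_prob 0%R 1%R]_z (g (beta0 + b * z))%:E \is a fin_num)%E.
    by apply: integral01_fin_num => // z.
  (* The two nonnegative integrands add up to 1, which gives the mean of [g] without integrating a
     difference. *)
  have : (\int[normal_prob 0%R 1%R]_z (g (beta0 + b * z))%:E +
          \int[normal_prob 0%R 1%R]_z ((1 - expR (- l))%:E * (r z)%:E) = 1)%E.
    rewrite -ge0_integralD//.
    - under eq_integral do rewrite -EFinM -EFinD subrK.
      by rewrite integral_cst//= probability_setT mule1.
    - by move=> z _; rewrite lee_fin; case/andP: (g01 (beta0 + b * z)).
    - exact/measurable_EFinP.
    - by move=> z _; rewrite mule_ge0// lee_fin ?subr_ge0//; case/andP: (r01 z).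
    - by apply: measurable_funeM; exact/measurable_EFinP.
  rewrite ge0_integralZl//; last 3 first.
  - exact/measurable_EFinP.
  - by move=> z _; rewrite lee_fin; case/andP: (r01 z).
  - by rewrite lee_fin subr_ge0.
  rewrite rI -(fineK gfin) -EFinM -EFinD => -[gh].
  by congr EFin; lra.
pose e (A : {set 'I_n}) (s : {ffun 'I_n -> bool}) := expR (l * (c - (hamming s A)%:R)).
have e0 A s : 0 <= e A s by exact: expR_ge0.
have msum (f : {set 'I_n} -> {ffun 'I_n -> bool} -> T -> R) :
    (forall A s, measurable_fun setT (f A s)) ->
    measurable_fun setT (fun w => \sum_A \sum_s e A s * f A s w).
  move=> mf; apply: measurable_sum => A; apply: measurable_sum => s.
  exact: measurable_funM.
have isum (f : {set 'I_n} -> {ffun 'I_n -> bool} -> T -> R) :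
    (forall A s, measurable_fun setT (f A s)) -> (forall A s w, 0 <= f A s w) ->
    (\int[P]_w (\sum_A \sum_s e A s * f A s w)%:E
     = \sum_A \sum_s (e A s)%:E * \int[P]_w (f A s w)%:E)%E.
  move=> mf f0; under eq_integral do rewrite -sumEFin.
  rewrite ge0_integral_sum//; last 2 first.
  - move=> A; apply/measurable_EFinP; apply: measurable_sum => s.
    exact: measurable_funM.
  - by move=> A w _; rewrite lee_fin sumr_ge0// => s _; rewrite mulr_ge0.
  apply: eq_bigr => A _; under eq_integral do rewrite -sumEFin.
  rewrite ge0_integral_sum//; last 2 first.
  - by move=> s; apply/measurable_EFinP; exact: measurable_funM.
  - by move=> s w _; rewrite lee_fin mulr_ge0.
  apply: eq_bigr => s _; under eq_integral do rewrite EFinM.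
  rewrite ge0_integralZl//; first exact/measurable_EFinP.
    by move=> w _; rewrite lee_fin.
  by rewrite lee_fin.
apply: (@le_trans _ _ (\int[P]_w (\sum_A \sum_s e A s *
    (\1_(halfspace_pattern X A `&` labelled s) w : R))%:E)%E).
  have mEC := measurableC mE.
  rewrite -[X in P X]setIT -integral_indic//.
  apply: ge0_le_integral => //.
  - exact/measurable_EFinP.
  - by apply/measurable_EFinP/msum => A s; exact: measurable_indic.
  - by move=> w _; rewrite lee_fin; exact: pattern_cover.
(* Each labelling event is exchanged for its conditional probability given the covariates. *)
have -> : (\int[P]_w (\sum_A \sum_s e A s *
    (\1_(halfspace_pattern X A `&` labelled s) w : R))%:E =
    \int[P]_w (\sum_A \sum_s e A s * (\1_(halfspace_pattern X A) w * cp s w))%:E)%E.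
  rewrite isum//; last by move=> A s; exact: measurable_indic.
  rewrite isum//; last 2 first.
  - by move=> A s; exact: measurable_funM.
  - by move=> A s w; rewrite mulr_ge0.
  apply: eq_bigr => A _; apply: eq_bigr => s _; congr (_ * _)%E.
  by rewrite -pattern_labelled_prob integral_indic// setIT.
apply: (@le_trans _ _ (\int[P]_w ((expR (l * c) * N0)%:E * (\prod_i g (t i w))%:E)))%E.
  apply: ge0_le_integral => //.
  - move=> w _; rewrite lee_fin sumr_ge0// => A _; rewrite sumr_ge0// => s _.
    by rewrite !mulr_ge0.
  - by apply/measurable_EFinP/msum => A s; exact: measurable_funM.
  - apply/measurable_EFinP; apply: measurable_funM => //.
    by apply: measurable_prod => i _; apply: (measurableT_comp mg); exact: measurable_lin_pred.
  move=> w _; rewrite -EFinM lee_fin.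
  have := halfspace_pattern_count X w dn; rewrite -/N0 => count.
  have G0 : 0 <= \prod_i g (t i w).
    by apply: prodr_ge0 => i _; case/andP: (g01 (t i w)).
  (* For fixed covariates the sum over labellings has a bound independent of the pattern, so the
     number of realised patterns factors out. *)
  apply: (@le_trans _ _
      (\sum_A expR (l * c) * (\1_(halfspace_pattern X A) w * \prod_i g (t i w)))).
    apply: ler_sum => A _.
    rewrite (eq_bigr (fun s => expR (l * c) * (\1_(halfspace_pattern X A) w *
       (expR (- (l * (hamming s A)%:R)) * cp s w)))); last first.
      by move=> s _; rewrite /e mulrBr expRD; ring.
    rewrite -!mulr_sumr ler_wpM2l ?expR_ge0// ler_wpM2l//.
    exact: sum_labels_le.
  rewrite -mulr_sumr -mulr_suml -mulrA ler_wpM2l ?expR_ge0//.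
  by rewrite ler_wpM2r.
rewrite ge0_integralZl//; last 3 first.
- by apply/measurable_EFinP/measurable_prod => i _; apply: measurableT_comp => //;
     exact: measurable_lin_pred.
- by move=> w _; rewrite lee_fin; apply: prodr_ge0 => i _; case/andP: (g01 (t i w)).
- by rewrite lee_fin mulr_ge0// expR_ge0.
rewrite integral_prod_lin_pred//; under eq_bigr do rewrite gE.
by rewrite prodEFin -EFinM big_const_ord iter_mulr_1.
Qed.

End model.

(** * Choice of the exponential parameter *)

Lemma h_const01 (R : realType) (b g : R) : 0 <= h_const b g <= 1.
Proof.
have mr : measurable_fun [set: R] (fun z => Phi (- `|b + g * z|)).
  apply: (measurableT_comp measurable_Phi); apply: measurableT_comp => //.
  apply: measurableT_comp => //.
  by apply: measurable_funD => //; exact: measurable_funM.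
have r01 z : 0 <= Phi (- `|b + g * z|) <= 1 by rewrite Phi_ge0 Phi_le1.
have fin := integral01_fin_num (normal_prob (0 : R) 1) mr r01.
apply/andP; split.
  by apply/fine_ge0/integral_ge0 => z _; rewrite lee_fin Phi_ge0.
rewrite -lee_fin /h_const fineK//.
apply: (@le_trans _ _ (\int[normal_prob (0 : R) 1]_z (cst 1 z))%E).
  apply: ge0_le_integral => //=.
  - by move=> z _; rewrite lee_fin Phi_ge0.
  - exact/measurable_EFinP.
  - by move=> z _; rewrite lee_fin Phi_le1.
by rewrite integral_cst//= probability_setT mule1.
Qed.

(* Squaring the radius [dl] gains [4 * DL], of which the union bound only
   consumes [DL]. *)
Lemma chernoff_exponent_le (R : realType) (n DL eps r h dl : R) :
  0 <= n -> 0 <= DL -> 0 <= eps -> 0 <= r -> n * r ^+ 2 = 2 * DL -> dl = eps + r ->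
  4 * dl * (n * (h - dl)) + DL + n * ((4 * dl) ^+ 2 / 8 - 4 * dl * h)
    <= - (2 * eps ^+ 2 * n).
Proof.
move=> n0 DL0 e0 r0 r2 ->.
have -> : 4 * (eps + r) * (n * (h - (eps + r))) + DL
      + n * ((4 * (eps + r)) ^+ 2 / 8 - 4 * (eps + r) * h)
    = DL - 2 * (eps ^+ 2 * n) - 4 * (n * eps * r) - 2 * (n * r ^+ 2).
  by field.
have nr : 0 <= n * eps * r by rewrite !mulr_ge0.
by rewrite r2; lra.
Qed.

Theorem theorem2p5 (R : realType) (dT : measure_display) (T : measurableType dT)
  (P : probability T R) (n d : nat) (hd : (1 <= d)%N) (hnd : (d < n)%N)
  (X : 'I_n -> 'I_d -> T -> R) (Y : 'I_n -> T -> R)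
  (beta0 : R) (beta : 'I_d -> R)
  (mX : forall i j, measurable_fun setT (X i j))
  (mY : forall i, measurable_fun setT (Y i))
  (Ypm : forall i w, Y i w = 1 \/ Y i w = -1)
  (* the coordinates X i j are mutually independent *)
  (Xindep : forall A : 'I_n -> 'I_d -> set R, (forall i j, measurable (A i j)) ->
     P (\bigcap_(i in [set: 'I_n]) \bigcap_(j in [set: 'I_d]) (X i j @^-1` A i j))
     = (\prod_(i < n) \prod_(j < d) P (X i j @^-1` A i j))%E)
  (* each coordinate is N(0,1), so x_i ~ N(0, I_d) i.i.d. *)
  (Xnormal : forall i j (A : set R), measurable A ->
     P (X i j @^-1` A) = normal_prob 0 1 A)
  (* conditional law of (y_i) given (x_i): conditionally independent,
     P(y_i = 1 | x) = Phi(xbar_i . betabar) *)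
  (Ycond : forall (A : 'I_n -> 'I_d -> set R) (y : 'I_n -> R),
     (forall i j, measurable (A i j)) -> (forall i, y i = 1 \/ y i = -1) ->
     let B := \bigcap_(i in [set: 'I_n]) \bigcap_(j in [set: 'I_d])
                (X i j @^-1` A i j) in
     P (B `&` [set w | forall i, Y i w = y i])
     = (\int[P]_w (\1_B w * \prod_(i < n)
                     cond_prob (y i) (lin_pred beta0 beta (fun j => X i j w)))%:E)%E)
  (eps : R) (heps : 0 < eps) :
  let gamma0 := Num.sqrt (\sum_(j < d) beta j ^+ 2) in
  let h := h_const beta0 gamma0 in
  let E := [set w | n%:R * (h - eps
                 - Num.sqrt (2 * ln (expR 1 * n%:R / (d.+1)%:R) / (n%:R / (d.+1)%:R)))
                 <= sstar (fun i j => X i j w) (fun i => Y i w)] in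
  measurable E /\ ((1 - expR (- (2 * eps ^+ 2 * n%:R)))%:E <= P E)%E.
Proof.
move=> gamma0 h E.
set r := Num.sqrt (2 * _ / _) in E *.
pose L : R := ln (expR 1 * n%:R / d.+1%:R).
(* [dl] is the total deviation below [h]; the parameter [4 * dl] minimises [n (l ^ 2 / 8 - l dl)]
   over [l], with value [- 2 n dl ^ 2]. *)
pose dl := eps + r.
have n0 : 0 < n%:R :> R by rewrite ltr0n (leq_ltn_trans _ hnd).
have d0 : 0 < d.+1%:R :> R by rewrite ltr0n.
have N1 : 1 <= expR 1 * n%:R / d.+1%:R :> R.
  rewrite ler_pdivlMr// mul1r (@le_trans _ _ n%:R) ?ler_nat//.
  by rewrite ler_peMl ?ler0n// -[leLHS]expR0 ler_expR.
have L0 : 0 <= L by exact: ln_ge0.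
have dl0 : 0 <= 4 * dl by rewrite mulr_ge0// addr_ge0 ?sqrtr_ge0// ltW.
have mE : measurable E by exact: measurable_le_sstar.
split=> //.
have : (P (~` E) <= (expR (- (2 * eps ^+ 2 * n%:R)))%:E)%E.
  have := sstar_tail_le mX Xindep Xnormal mY Ypm Ycond
    (n%:R * (h - eps - r)) hnd dl0.
  rewrite -/gamma0 -/h => /le_trans; apply; rewrite lee_fin.
  have -> : (expR 1 * n%:R / d.+1%:R) ^+ d.+1 = expR (d.+1%:R * L) :> R.
    by rewrite expRM_natl lnK// posrE (lt_le_trans ltr01).
  have hoeff : (1 - (1 - expR (- (4 * dl))) * h) ^+ n
      <= expR (n%:R * ((4 * dl) ^+ 2 / 8 - 4 * dl * h)).
    have -> : 1 - (1 - expR (- (4 * dl))) * h = 1 - h + h * expR (- (4 * dl)) by ring.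
    have /andP[h0 h1] := h_const01 beta0 gamma0.
    rewrite expRM_natl lerXn2r ?nnegrE ?expR_ge0//.
      by rewrite addr_ge0 ?subr_ge0// mulr_ge0// expR_ge0.
    by apply: bernoulli_mgf_le => //; rewrite h0.
  apply: le_trans (ler_wpM2l _ hoeff) _; first by rewrite mulr_ge0 ?expR_ge0.
  rewrite -!expRD ler_expR (_ : h - eps - r = h - dl); last by rewrite /dl; ring.
  (* Here [DL] is [(d + 1) * L], the logarithm of the bound on the number of patterns, and
     [n r ^ 2 = 2 DL] by the choice of [r]. *)
  apply: (@chernoff_exponent_le _ _ _ _ r) => //;
    rewrite ?sqrtr_ge0 ?mulr_ge0 ?(ltW n0) ?(ltW d0) ?(ltW heps)//.
  rewrite /r sqr_sqrtr; last by rewrite divr_ge0 ?mulr_ge0// divr_ge0// ltW.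
  by rewrite invf_div -/L; field; rewrite gt_eqF.
rewrite probability_setC// leeBlDr; last exact: fin_num_measure.
by rewrite EFinB leeBlDl.
Qed.
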